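(* Let $A:U_\infty\to\mathcal M^{n\times n}_{\rm sym}$, $K:U_\infty\to\mathcal M^{n\times n}$ and $B:U_\infty\times J\to\mathbb R^n$ be such that, for some constants $c_0>0$, $M_1>0$, $c_1\ge0$, $c_2\ge0$ and for all $(x,t)\in U_\infty$, $\xi\in\mathbb R^n$, $$\xi^{\rm T}A(x,t)\xi\ge c_0|\xi|^2,\qquad{\rm Tr}(A(x,t))\le M_1,\qquad -c_1|\xi|^2\le\xi^{\rm T}K(x,t)\xi\le c_2|\xi|^2 .$$ Let $u\in C(\overline{U_\infty})\cap C^{2,1}_{x,t}(U_\infty)$, with $u(U_\infty)\subset J$, be a solution of the problem $$Lu=f\ \text{ in }U\times(0,\infty),\qquad u=g\ \text{ on }\Gamma\times(0,\infty),\qquad u(x,0)=u_0(x)\ \text{ in }U,$$ where $f:U_\infty\to\mathbb R$, $g:\Gamma\times(0,\infty)\to\mathbb R$, $u_0:U\to\mathbb R$ are given functions. Assume that $u$ satisfies the Range Condition (see context), and assume the following. (i) There is a continuous, increasing function $\bar b:[0,\infty)\to[0,\infty)$ which tends to infinity as $t\to\infty$, and a number $\gamma_0>0$ such that $|B(x,t,s)|\le\bar b(t)(1+|s|)^{\gamma_0}$ for all $(x,t)\in U_\infty$ and $s\in J$. (ii) There is a continuous function $F:[0,\infty)\to[0,\infty)$ such that $|f(x,t)|\le F(t)$ for all $(x,t)\in U_\infty$ and $\int_0^\infty F(\tau)\,{\rm d}\tau<\infty$. (iii) There are numbers $u_*\in J$, $T^*>0$ and a decreasing, continuous function $\widetilde\Lambda(t)\ge0$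 on $[T^*,\infty)$ such that $$\max_{(x,\tau)\in\Gamma\times[t,t+1]}|g(x,\tau)-u_*|+\int_t^{t+1}F(\tau)\,{\rm d}\tau\le\widetilde\Lambda(t)\quad\text{for all }t\ge T^*.$$ (iv) For any $\mu>0$, the functions $z_0(t):=\mu\bar b(t)$ and $\bar\Lambda(t):=\widetilde\Lambda(t/4)$ satisfy Condition (Z) (see context) and $\limsup_{t\to\infty}\left(\bar\Lambda(t)e^{\frac{d}{c_0}z_0(t)}\right)=0$. Then $$\lim_{t\to\infty}\left(\max_{x\in\bar U}|u(x,t)-u_*|\right)=0.$$
   Context: $n\ge1$ is fixed; $U$ is a non-empty, open, bounded subset of $\mathbb R^n$ with boundary $\Gamma$, closure $\bar U$ and diameter $d=\max\{|x-x'|:x,x'\in\bar U\}$. $U_\infty=U\times(0,\infty)$, $\overline{U_\infty}=\bar U\times[0,\infty)$. $\mathcal M^{n\times n}$ (resp. $\mathcal M^{n\times n}_{\rm sym}$) is the set of real (resp. real symmetric) $n\times n$ matrices. $C^{2,1}_{x,t}(U\times I)$ is the class of continuous functions on $U\times I$ with continuous partial derivatives $\partial u/\partial t$, $\partial u/\partial x_i$, $\partial^2u/\partial x_i\partial x_j$. $\langle A,B\rangle={\rm Tr}(A^{\rm T}B)$; $D^2u$, $\nabla u$ are the Hessian and gradient in $x$. ''Increasing'', ''decreasing'', ''monotone'' are in the non-strict sense. $J$ is an interval in $\mathbb R$ with non-empty interior and $P\in C^1(J,\mathbb R)$ with $P'\in C(J,[0,\infty))$. The nonlinear operator $L$ is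 $$Lu=\frac{\partial u}{\partial t}-\langle A(x,t),D^2u\rangle+B(x,t,u)\cdot\nabla u+P'(u)(K(x,t)\nabla u)\cdot\nabla u.$$ Range Condition: either $J=\mathbb R$, or one of the following holds: if $J=[a,\infty)$ or $J=(-\infty,b]$, then $u(\overline{U_\infty})\subset J$; if $J=(a,\infty)$, then $u(\overline{U_\infty})\subset[m,\infty)$ for some $m>a$; if $J=(-\infty,b)$, then $u(\overline{U_\infty})\subset(-\infty,M]$ for some $M<b$; if $J$ is bounded, then $u(\overline{U_\infty})\subset[m,M]$ with $m,M\in J$. (That is, $u$ satisfies the requirement corresponding to the form of $J$.) Condition (Z): two nonnegative functions $z_0(t)$ and $\bar\Lambda(t)$, defined for sufficiently large $t$, satisfy Condition (Z) if there are numbers $T^*\ge0$, $t_*\ge4T^*$ and $\varepsilon_*>0$ such that $\int_{T^*}^\infty e^{-\frac{d}{c_0}z_0(x)}\,{\rm d}x=\infty$ and, for any $\varepsilon\in(0,\varepsilon_* )$, the function $$t\in[t_*,\infty)\mapsto\bar\Lambda(t)\exp\left(e^{-\frac{d^2}{2c_0}-\varepsilon}\int_{t_*}^{t+1}e^{-\frac{d}{c_0}z_0(x)}\,{\rm d}x\right)$$ is monotone. (These $T^*,t_*,\varepsilon_*$ need not be related to other numbers of the same name.) *)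

(* Defs.v *)
From HB Require Import structures.
From mathcomp Require Import all_boot all_order all_algebra.
From mathcomp Require Import all_classical all_reals all_analysis.

Set Implicit Arguments.
Unset Strict Implicit.
Unset Printing Implicit Defensive.
Import Order.TTheory GRing.Theory Num.Theory.
Import numFieldNormedType.Exports.
Local Open Scope classical_set_scope.
Local Open Scope ring_scope.

(* Points of R^n are row vectors, so the product of a matrix M with a vector
   v is written v *m M^T.  Functions on subsets of R^n, R^n x R or R are total
   functions of which only the values on the relevant subset are constrained.

   Pitfall: the library's norm `|x| on 'rV[R]_n is the sup norm.  It induces
   the usual topology and the usual bounded sets; wherever the Euclidean norm
   itself matters, enorm is used. *)

Definition dotv (R : realType) (n : nat) (v w : 'rV[R]_n) : R :=
  \sum_(i < n) v 0 i * w 0 i.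

Definition enorm (R : realType) (n : nat) (v : 'rV[R]_n) : R :=
  Num.sqrt (dotv v v).

Definition quadform (R : realType) (n : nat) (M : 'M[R]_n) (xi : 'rV[R]_n) : R :=
  (xi *m M *m xi^T) 0 0.

(* For U bounded and nonempty the supremum is attained, i.e. is a maximum. *)
Definition diam (R : realType) (n : nat) (U : set 'rV[R]_n) : R :=
  sup [set enorm (x.1 - x.2) | x in closure U `*` closure U].

Definition bdry (R : realType) (n : nat) (U : set 'rV[R]_n) : set 'rV[R]_n :=
  closure U `\` interior U.

Definition cylinder (R : realType) (n : nat) (U : set 'rV[R]_n)
  : set ('rV[R]_n * R) := U `*` `]0, +oo[.

Definition ccylinder (R : realType) (n : nat) (U : set 'rV[R]_n)
  : set ('rV[R]_n * R) := closure U `*` `[0, +oo[.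

Definition tderivable (R : realType) (n : nat) (u : 'rV[R]_n * R -> R)
    (p : 'rV[R]_n * R) : Prop :=
  derivable (fun s => u (p.1, s)) p.2 1.

Definition dt (R : realType) (n : nat) (u : 'rV[R]_n * R -> R)
    (p : 'rV[R]_n * R) : R :=
  'D_1 (fun s => u (p.1, s)) p.2.

Definition xderivable (R : realType) (n : nat) (i : 'I_n)
    (u : 'rV[R]_n * R -> R) (p : 'rV[R]_n * R) : Prop :=
  derivable (fun y => u (y, p.2)) p.1 (delta_mx 0 i).

Definition dx (R : realType) (n : nat) (i : 'I_n) (u : 'rV[R]_n * R -> R)
    (p : 'rV[R]_n * R) : R :=
  'D_(delta_mx 0 i) (fun y => u (y, p.2)) p.1.

Definition grad (R : realType) (n : nat) (u : 'rV[R]_n * R -> R)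
    (p : 'rV[R]_n * R) : 'rV[R]_n :=
  \row_i dx i u p.

Definition hess (R : realType) (n : nat) (u : 'rV[R]_n * R -> R)
    (p : 'rV[R]_n * R) : 'M[R]_n :=
  \matrix_(i, j) dx i (dx j u) p.

(* Meant for open D only: the partial derivatives are two-sided. *)
Definition C21 (R : realType) (n : nat) (D : set ('rV[R]_n * R))
    (u : 'rV[R]_n * R -> R) : Prop :=
  [/\ {within D, continuous u},
      (forall p, D p -> tderivable u p) /\ {within D, continuous (dt u)},
      (forall i : 'I_n, (forall p, D p -> xderivable i u p) /\
         {within D, continuous (dx i u)}) &
      (forall i j : 'I_n, (forall p, D p -> xderivable i (dx j u) p) /\
         {within D, continuous (dx i (dx j u))})].

(* Difference quotients only use points of J, so that the derivative is
   one-sided at an endpoint of the interval J that belongs to J. *)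
Definition quotient_filter (R : realType) (J : set R) (P : R -> R) (s : R) :=
  (P y - P s) / (y - s) @[y --> within J s^'].

Definition derive_in (R : realType) (J : set R) (P : R -> R) (s : R) : R :=
  lim (quotient_filter J P s).

Definition C1_in (R : realType) (J : set R) (P : R -> R) : Prop :=
  (forall s, J s -> cvg (quotient_filter J P s)) /\
  {within J, continuous (derive_in J P)}.

Definition Lop (R : realType) (n : nat) (J : set R) (P : R -> R)
    (A K : 'rV[R]_n * R -> 'M[R]_n) (B : 'rV[R]_n * R -> R -> 'rV[R]_n)
    (u : 'rV[R]_n * R -> R) (p : 'rV[R]_n * R) : R :=
  dt u p - \tr ((A p)^T *m hess u p) + dotv (B p (u p)) (grad u p)
  + derive_in J P (u p) * dotv (grad u p *m (K p)^T) (grad u p).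

(* E stands for the range of u on the closed cylinder. *)
Definition range_condition (R : realType) (J E : set R) : Prop :=
  J = setT \/
  ((exists a : R, J = `[a, +oo[%classic \/ J = `]-oo, a]%classic) /\ E `<=` J) \/
  (exists a : R, (J = `]a, +oo[%classic) /\ exists2 m : R, a < m & E `<=` `[m, +oo[) \/
  (exists b : R, (J = `]-oo, b[%classic) /\ exists2 M : R, M < b & E `<=` `]-oo, M]) \/
  (bounded_set J /\ exists m M : R, [/\ J m, J M & E `<=` `[m, M]]).

(* z0 is a function with domain [a, +oo[ and Lam a function with domain
   [b, +oo[; since both are total here, the requirements a <= T and b <= t1
   express that the condition only refers to values inside the domains. *)
Definition condition_Z (R : realType) (d c0 a b : R) (z0 Lam : R -> R) : Prop :=
  exists T t1 eps1 : R,
    [/\ 0 <= T /\ a <= T, 4 * T <= t1 /\ b <= t1, 0 < eps1,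
        (\int[lebesgue_measure]_(x in `[T, +oo[)
            (expR (- (d / c0 * z0 x)))%:E = +oo)%E &
        forall eps : R, 0 < eps < eps1 ->
          let h := fun t : R => Lam t *
            expR (expR (- (d ^+ 2 / (2 * c0)) - eps) *
              \int[lebesgue_measure]_(x in `[t1, t + 1])
                 expR (- (d / c0 * z0 x))) in
          {in `[t1, +oo[ &, {homo h : s t / s <= t}} \/
          {in `[t1, +oo[ &, {homo h : s t /~ s <= t}}].

(* Main.v *)
(* At an interior maximum of u minus a barrier the gradients agree and the
   Hessians are ordered, so the nonlinear equation can be compared with a barrier
   directly, without transforming u.  On [a, a + 1] the barrier
     beta + int_a^t F + m (1 - delta (exp (lam (x1 - D) + kap (t - a)) - 1)),
   with lam of the order of the drift bbar (a + 1), shows that one unit of time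
   multiplies the bound m for the deviation of u from ustar by 1 - eta a, up to
   the data Lam a, where eta a = C1 exp (- C2 bbar (a + 1)).  Hence
   m (a + 1) <= (1 - eta a) m a + Lam a, and m tends to 0 because the sum of the
   eta's diverges while Lam / eta tends to 0; both follow from hypothesis (iv)
   for the single mu with d mu / c0 = C2. *)

Require Import Defs.
From HB Require Import structures.
From mathcomp Require Import all_boot all_order all_algebra.
From mathcomp Require Import all_classical all_reals all_analysis.
From mathcomp Require Import measurable_realfun ring lra.

Set Implicit Arguments.
Unset Strict Implicit.
Unset Printing Implicit Defensive.
Import Order.TTheory GRing.Theory Num.Theory.
Import numFieldNormedType.Exports.
Local Open Scope classical_set_scope.
Local Open Scope ring_scope.

(** The dangerous term is the quadratic one. In the comparison it is of second order in the
    amplitude of the barrier's exponential, while the gain from ellipticity is of first order. Hence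
    a small amplitude, measured against c0 / (kk M) with kk a bound for the quadratic coefficient
    and M one for the deviation, lets ellipticity win for data of any size. This needs M and kk in
    advance. A cruder use of the same comparison, with amplitude 0, bounds u globally. Then the
    factor (1 + |u|)^gamma0 of the drift is at most a constant, and the Range Condition puts the
    values of u into a compact segment of J, on which the continuous P' is bounded. The exponential
    depends on a single coordinate, so its Hessian has one nonzero entry and the trace term reduces
    to one diagonal entry of A, which is at least c0. Estimating drift and quadratic term by
    absolute values gives one differential inequality satisfied by both u - ustar and ustar - u, so
    upper bounds suffice. *)

(** * Linear algebra: the trace of a positive definite times a negative semidefinite matrix *)

Lemma quadform_block (R : realType) n (a s : R) (b : 'rV[R]_n) (c : 'cV[R]_n)
    (D : 'M[R]_n) (xi : 'rV[R]_n) :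
  quadform (block_mx a%:M b c D : 'M[R]_(1 + n)) (row_mx s%:M xi) =
  a * s ^+ 2 + s * (b *m xi^T) 0 0 + s * (xi *m c) 0 0 + quadform D xi.
Proof.
rewrite /quadform tr_row_mx mul_row_block mul_row_col !mulmxDl.
rewrite tr_scalar_mx -scalar_mxM !mul_scalar_mx -!scalemxAl !mul_mx_scalar.
rewrite !mxE eqxx mulr1n; ring.
Qed.

Lemma mxtrace_block_mul (R : realType) n (a h : R) (b g : 'rV[R]_n)
    (c k : 'cV[R]_n) (S D : 'M[R]_n) :
  \tr ((block_mx a%:M b c S : 'M[R]_(1 + n)) *m block_mx h%:M g k D) =
  a * h + (b *m k) 0 0 + \tr (c *m g) + \tr (S *m D).
Proof.
rewrite mulmx_block mxtrace_block !mxtraceD -scalar_mxM mxtrace_scalar mulr1n.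
by rewrite [\tr (b *m k)]big_ord1 !addrA.
Qed.

(* Peeling off the rank one part of the first row of A leaves its Schur
   complement, which is positive definite again. *)
Lemma mxtrace_posdef_nsd (R : realType) n (A H : 'M[R]_n) :
  A^T = A -> (forall xi, xi != 0 -> 0 < quadform A xi) ->
  (forall xi, quadform H xi <= 0) -> \tr (A *m H) <= 0.
Proof.
elim: n A H => [|n IHn] A H Asym Apos Hneg.
  by rewrite [X in \tr X]flatmx0 mxtrace0.
pose a := A ord0 ord0; pose b : 'rV[R]_n := @ursubmx _ 1 n 1 n A.
pose S0 : 'M[R]_n := @drsubmx _ 1 n 1 n A.
have AE : A = block_mx a%:M b b^T S0 :> 'M[R]_(1 + n).
  rewrite -[LHS](@submxK _ 1 n 1 n); congr block_mx.
  - apply/matrixP => i j; rewrite !ord1 !mxE /= mulr1n /a.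
    by congr (A _ _); apply/val_inj.
  - by rewrite /b trmx_ursub Asym.
pose h := H ord0 ord0; pose g : 'rV[R]_n := @ursubmx _ 1 n 1 n H.
pose g' : 'cV[R]_n := @dlsubmx _ 1 n 1 n H; pose D : 'M[R]_n := @drsubmx _ 1 n 1 n H.
have HE : H = block_mx h%:M g g' D :> 'M[R]_(1 + n).
  rewrite -[LHS](@submxK _ 1 n 1 n); congr block_mx.
  apply/matrixP => i j; rewrite !ord1 !mxE /= mulr1n /h.
  by congr (H _ _); apply/val_inj.
have qA s xi : quadform A (row_mx s%:M xi) =
    a * s ^+ 2 + s * (b *m xi^T) 0 0 *+ 2 + quadform S0 xi.
  rewrite AE quadform_block mulr2n !addrA; congr (_ + _ * _ + _).
  by rewrite -[in LHS](trmxK xi) -trmx_mul mxE.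
have a_gt0 : 0 < a.
  have := Apos (row_mx 1%:M 0); rewrite qA trmx0 mulmx0 mxE /quadform !mul0mx.
  rewrite !mxE expr1n mulr1 mulr0 mul0rn !addr0; apply.
  apply/eqP => /(congr1 (fun M : 'rV[R]_(1 + n) => M 0 (lshift n 0))).
  by rewrite row_mxEl !mxE => /eqP; rewrite oner_eq0.
pose S := S0 - a^-1 *: (b^T *m b).
have Ssym : S^T = S.
  by rewrite /S linearB linearZ /= trmx_mul trmxK /S0 trmx_drsub Asym.
have bE xi : (xi *m b^T) 0 0 = (b *m xi^T) 0 0.
  by rewrite -[in LHS](trmxK xi) -trmx_mul mxE.
have qS xi : quadform S xi = quadform S0 xi - a^-1 * (b *m xi^T) 0 0 ^+ 2.
  rewrite /quadform /S mulmxBr mulmxBl -scalemxAr -scalemxAl.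
  rewrite [LHS]mxE [X in _ + X]mxE [X in _ - X]mxE mulmxA -(mulmxA (xi *m _)).
  by rewrite [X in _ * X]mxE big_ord1 bE expr2.
(* The rank one part of [A] contributes the quadratic form of [H] at the first row (a, b) of [A];
   the Schur complement [S] only meets the lower right block of [H]. *)
have trE : \tr (A *m H) =
    a^-1 * quadform H (row_mx a%:M b) + \tr (S *m D).
  rewrite {1}HE {1}AE (mxtrace_block_mul a h b g b^T g' S0 D) HE.
  rewrite quadform_block /S mulmxBl linearB /= -scalemxAl linearZ /= -mulmxA.
  rewrite (mxtrace_mulC b^T (b *m D)) (mxtrace_mulC b^T g).
  rewrite ![\tr (_ *m b^T)]big_ord1 -/(quadform D b).
  by field; rewrite gt_eqF.
rewrite trE; have hq := Hneg (row_mx a%:M b).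
have htr : \tr (S *m D) <= 0.
  apply: IHn => // [xi xi0|xi].
    (* This first entry minimises the form of [A] for given [xi], and the minimum is the form of [S]
       at [xi]. *)
    have := Apos (row_mx (- a^-1 * (b *m xi^T) 0 0)%:M xi).
    rewrite qA qS; set z := (b *m xi^T) 0 0.
    have -> : a * (- a^-1 * z) ^+ 2 + - a^-1 * z * z *+ 2 = - (a^-1 * z ^+ 2).
      by field; rewrite gt_eqF.
    rewrite [- _ + _]addrC; apply; apply: contra xi0 => /eqP.
    by move/(congr1 (@rsubmx _ 1 1 n)); rewrite row_mxKr linear0 => ->.
  by have := Hneg (row_mx 0%:M xi); rewrite HE quadform_block; lra.
by rewrite -[leRHS]addr0 lerD// pmulr_rle0 ?invr_gt0.
Qed.

(** * Calculus: directional derivatives and the conditions at a local maximum *)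

Lemma near_norm (R : realType) (V : normedModType R) (x : V) (P : V -> Prop) :
  (\forall y \near x, P y) ->
  exists2 r : R, 0 < r & forall y, `|y - x| < r -> P y.
Proof.
move=> /nbhs_ballP[r r0 H]; exists r => // y yx; apply: H.
by rewrite -ball_normE /ball_ /= distrC.
Qed.

Lemma is_derive_lineP (R : realType) (V : normedModType R) (f : V -> R)
    (y e : V) (s d : R) :
  is_derive s 1 (fun t => f (y + t *: e)) d <-> is_derive (y + s *: e) e f d.
Proof.
have E : (fun h : R => h^-1 *: (((fun t => f (y + t *: e)) \o shift s) (h *: 1)
      - f (y + s *: e))) =
    (fun h : R => h^-1 *: ((f \o shift (y + s *: e)) (h *: e) - f (y + s *: e))).
  apply/funext => h /=; congr (_ *: (f _ - _)).
  by rewrite /shift /= [h *: 1]mulr1 scalerDl addrCA.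
split=> -[df <-].
  have df' : derivable f (y + s *: e) e by rewrite /derivable -E.
  by apply: (DeriveDef df'); rewrite /derive E.
have df' : derivable (fun t : R => f (y + t *: e)) s 1 by rewrite /derivable E.
by apply: (DeriveDef df'); rewrite /derive E.
Qed.

(** Inductive step of the fact that continuous partial derivatives give all directional ones. The
    increment along [v + c *: e] is the increment along [v] followed by one along [e]; the mean
    value theorem turns the latter into a value of [df] near [x], and continuity of [df] at [x]
    finishes. *)
Lemma is_derive_dirD (R : realType) (V : normedModType R) (f : V -> R)
    (x v e : V) (c d : R) (df : V -> R) :
  (\forall y \near x, is_derive y e f (df y)) -> {for x, continuous df} ->
  is_derive x v f d -> is_derive x (v + c *: e) f (d + c * df x).
Proof.
move=> fe dfx fv.
have fv' : h^-1 *: ((f \o shift x) (h *: v) - f x) @[h --> 0^'] --> d.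
  by case: fv => + <-; exact.
suff key : h^-1 *: (f (h *: (v + c *: e) + x) - f (h *: v + x)) @[h --> 0^']
    --> c * df x.
  suff lim : h^-1 *: ((f \o shift x) (h *: (v + c *: e)) - f x) @[h --> 0^']
      --> d + c * df x.
    by split; [apply/cvg_ex; eexists; exact: lim|exact/cvg_lim].
  rewrite (_ : (fun h => _) = (fun h : R =>
      h^-1 *: ((f \o shift x) (h *: v) - f x) +
      h^-1 *: (f (h *: (v + c *: e) + x) - f (h *: v + x)))).
    exact: cvgD fv' key.
  by apply/funext => h; rewrite -scalerDr; congr (_ *: _); rewrite /shift /=; ring.
apply/cvgrPdist_le => /= eps eps0.
have [r /= r0 fr] : exists2 r : R, 0 < r & forall y, `|y - x| < r ->
    is_derive y e f (df y) /\ `|df x - df y| <= eps / (`|c| + 1).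
  (* The 1 in the denominator covers c = 0. *)
  have e0 : 0 < eps / (`|c| + 1) by rewrite divr_gt0// ltr_wpDl.
  have dfx' := (cvgrPdist_le _ _).1 dfx _ e0.
  exact: near_norm (filterI fe (dfx' _)).
have N0 : 0 < `|v| + `|c| * `|e| + 1 by rewrite ltr_wpDl// addr_ge0// mulr_ge0.
near=> h.
have h0 : h != 0 by near: h; exact: nbhs_dnbhs_neq.
have hN : `|h| * (`|v| + `|c| * `|e| + 1) < r.
  rewrite -ltr_pdivlMr//; near: h; apply: dnbhs0_lt; exact: divr_gt0.
have close (s : R) : `|s| <= `|h * c| -> `|(h *: v + x) + s *: e - x| < r.
  move=> sc; apply: le_lt_trans hN.
  rewrite addrAC addrK (le_trans (ler_normD _ _))// !normrZ mulrDr mulr1.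
  rewrite ler_wpDr// mulrDr lerD2l mulrA -normrM; exact: ler_wpM2r.
pose g (t : R) := f ((h *: v + x) + t *: e).
have dg (t : R) : `|t| <= `|h * c| ->
    is_derive t 1 g (df ((h *: v + x) + t *: e)).
  by move=> /close/fr[tt _]; exact/is_derive_lineP.
have cg (t : R) : `|t| <= `|h * c| -> {for t, continuous g}.
  by move=> /dg [tt _]; apply/differentiable_continuous/derivable1_diffP.
(* Two cases, because the mean value theorem wants an ordered segment and [h * c] may have either
   sign. *)
have [s sc gE] : exists2 s : R, `|s| <= `|h * c| &
    g (h * c) - g 0 = df ((h *: v + x) + s *: e) * (h * c).
  have [hc|hc] := leP 0 (h * c).
    have itvh (t : R) : t \in `[0, h * c] -> `|t| <= `|h * c|.
      by rewrite in_itv /= => /andP[t0 th]; rewrite !ger0_norm.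
    have [| |s sI ->] := @MVT_segment R g
        (fun t => df ((h *: v + x) + t *: e)) _ _ hc.
    - move=> t tI; apply: dg; apply: itvh; exact: subset_itv_oo_cc.
    - apply: continuous_in_subspaceT => t; rewrite inE => tI.
      by apply: cg; apply: itvh.
    by exists s; [exact: itvh|rewrite subr0].
  have itvh (t : R) : t \in `[h * c, 0] -> `|t| <= `|h * c|.
    rewrite in_itv /= => /andP[ht t0].
    by rewrite !ler0_norm// ?lerN2// ltW.
  have [| |s sI E] := @MVT_segment R g
      (fun t => df ((h *: v + x) + t *: e)) _ _ (ltW hc).
  - move=> t tI; apply: dg; apply: itvh; exact: subset_itv_oo_cc.
  - apply: continuous_in_subspaceT => t; rewrite inE => tI.
    by apply: cg; apply: itvh.
  by exists s; [exact: itvh|rewrite -opprB E; ring].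
have -> : f (h *: (v + c *: e) + x) - f (h *: v + x) = g (h * c) - g 0.
  rewrite /g scale0r addr0; congr (f _ - _).
  by rewrite scalerDr scalerA addrAC.
rewrite gE /GRing.scale /=.
rewrite (_ : h^-1 * _ = c * df ((h *: v + x) + s *: e)); last by field.
rewrite -mulrBr normrM.
have [_ dfy] := fr _ (close _ sc).
rewrite (le_trans (ler_wpM2l (normr_ge0 c) dfy))// mulrCA.
by rewrite ger_pMr// ler_pdivrMr ?mul1r ?lerDl// ltr_wpDl.
Unshelve. all: by end_near. Qed.

Lemma is_derive_partials (R : realType) n (f : 'rV[R]_n -> R) (x xi : 'rV[R]_n)
    (p : 'I_n -> 'rV[R]_n -> R) :
  (forall i, \forall y \near x, is_derive y (delta_mx 0 i) f (p i y)) ->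
  (forall i, {for x, continuous (p i)}) ->
  is_derive x xi f (\sum_i xi 0 i * p i x).
Proof.
move=> fp cp; rewrite [X in is_derive _ X _ _](row_sum_delta xi).
elim: (index_enum _) => [|i s IH]; first by rewrite !big_nil; exact: is_derive0.
rewrite !big_cons addrC [X in is_derive _ _ _ X]addrC.
exact: is_derive_dirD.
Qed.

(** With d > 0 the first derivative [g1], which vanishes at 0, would be positive just to the right
    of 0, and by the mean value theorem [g] would exceed its maximum there. Differentiability of
    [g1] at 0 alone suffices for this. *)
Lemma second_derivative_max (R : realType) (g g1 : R -> R) (d : R) :
  (\forall s \near (0 : R), is_derive (s : R) 1 g (g1 s)) ->
  is_derive (0 : R) 1 g1 d ->
  (\forall s \near (0 : R), g s <= g 0) -> g1 0 = 0 /\ d <= 0.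
Proof.
move=> dg [dg1 g1E] gmax.
have [r /= r0 gr] : exists2 r : R, 0 < r & forall s : R, `|s| < r ->
    is_derive (s : R) 1 g (g1 s) /\ g s <= g 0.
  have [r r0 H] := near_norm (filterI dg gmax).
  by exists r => [//|y yr]; apply: H; rewrite subr0.
have g10 : g1 0 = 0.
  have rr : - r <= r by lra.
  have [| | |_ D0] := @derive1_at_max R g (- r) r 0 rr.
  - by move=> t; rewrite in_itv /= -ltr_norml => /gr [[]].
  - by rewrite in_itv /= r0 oppr_lt0 r0.
  - by move=> t; rewrite in_itv /= -ltr_norml => /gr [].
  have zr : `|0 : R| < r by rewrite normr0.
  by have [[_ D] _] := gr 0 zr; rewrite -D D0.
split=> //; rewrite leNgt; apply/negP => d0.
have : h^-1 *: ((g1 \o shift 0) (h *: 1) - g1 0) @[h --> 0^'] --> d.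
  by rewrite -g1E; exact: dg1.
move=> /(cvgr_gt d) - /(_ _ d0) => /near_norm[r2 r20 H].
pose h := Num.min r r2 / 2.
have m0 : 0 < Num.min r r2 by rewrite lt_min r0.
have [h0 hr hr2] : [/\ 0 < h, h < r & h < r2].
  have [? ?] : Num.min r r2 <= r /\ Num.min r r2 <= r2 by rewrite !ge_min !lexx orbT.
  by rewrite /h; split; lra.
have g1_gt0 s : 0 < s <= h -> 0 < g1 s.
  move=> /andP[s0 sh].
  have /(_ _)/= := H s; rewrite subr0 gtr0_norm// (le_lt_trans sh hr2).
  move=> /(_ isT (lt0r_neq0 s0)).
  by rewrite g10 subr0 addr0 [s *: 1]mulr1 /GRing.scale /= pmulr_rgt0 ?invr_gt0.
have norm_lt s : 0 <= s <= h -> `|s| < r.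
  by move=> /andP[s0 sh]; rewrite ger0_norm// (le_lt_trans sh).
have [| |s] := @MVT R g g1 0 h h0.
- by move=> s; rewrite in_itv /= => /andP[s0 sh]; apply: (gr _ _).1;
    apply: norm_lt; rewrite !ltW.
- apply: continuous_in_subspaceT => s.
  rewrite inE /= in_itv /= => /norm_lt/gr[[+ _] _].
  by move=> ?; apply/differentiable_continuous/derivable1_diffP.
rewrite in_itv /= subr0 => /andP[s0 sh] E.
have gh : g h <= g 0 by apply: (gr _ _).2; apply: norm_lt; rewrite lexx ltW.
have : 0 < g1 s * h by rewrite mulr_gt0// g1_gt0// s0 ltW.
by rewrite -E subr_gt0 ltNge gh.
Qed.

(** Reduction to one variable by restricting [f] to the lines x + s v. The chain rule along a line
    is [is_derive_partials], once for [f] near [x] and once for each [p j] at [x]. *)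
Lemma partials_max (R : realType) n (f : 'rV[R]_n -> R) (x : 'rV[R]_n)
    (p : 'I_n -> 'rV[R]_n -> R) (h : 'I_n -> 'I_n -> 'rV[R]_n -> R) :
  (forall i, \forall y \near x, is_derive y (delta_mx 0 i) f (p i y)) ->
  (forall i, \forall y \near x, {for y, continuous (p i)}) ->
  (forall i j, \forall y \near x, is_derive y (delta_mx 0 i) (p j) (h i j y)) ->
  (forall i j, {for x, continuous (h i j)}) ->
  (\forall y \near x, f y <= f x) ->
  (forall i, p i x = 0) /\
  (forall xi, quadform (\matrix_(i, j) h i j x) xi <= 0).
Proof.
move=> fp cp ph ch fmax.
have near_dir (P : 'rV[R]_n -> Prop) (v : 'rV[R]_n) :
    (\forall y \near x, P y) -> \forall s \near (0 : R), P (x + s *: v).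
  move=> xP; have : (fun s : R => x + s *: v) @ (0 : R) --> x + (0 : R) *: v.
    by apply: cvgD; [exact: cvg_cst|apply: cvgZl; exact: cvg_id].
  by rewrite scale0r addr0; apply.
have key (v : 'rV[R]_n) : \sum_i v 0 i * p i x = 0 /\
    \sum_j v 0 j * (\sum_i v 0 i * h i j x) <= 0.
  pose g (s : R) := f (x + s *: v).
  pose g1 (s : R) := \sum_j v 0 j * p j (x + s *: v).
  have [| | |g10 d0] := @second_derivative_max R g g1
      (\sum_j v 0 j * (\sum_i v 0 i * h i j x)).
  (* [is_derive_partials] is applied at the points x + s v, so the partial derivatives must exist on
     a neighbourhood of each of them. *)
  - have fpx : \forall y \near x,
        \forall z \near y, forall i, is_derive z (delta_mx 0 i) f (p i z).
      apply: near_join; exact: (@filter_forall _ 'I_n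
        (fun i y => is_derive y (delta_mx 0 i) f (p i y)) (nbhs x) _ fp).
    have cpx : \forall y \near x, forall i, {for y, continuous (p i)}.
      exact: (@filter_forall _ 'I_n
        (fun i y => {for y, continuous (p i)}) (nbhs x) _ cp).
    apply: (filterS _ (near_dir _ v (filterI fpx cpx))) => s [fpy cpy].
    apply/is_derive_lineP; apply: is_derive_partials => // i.
    by apply: (filterS _ fpy) => z; exact.
  - have dp j : is_derive (0 : R) 1 (fun s => p j (x + s *: v))
        (\sum_i v 0 i * h i j x).
      apply/is_derive_lineP; rewrite scale0r addr0.
      by apply: (is_derive_partials v (p := fun i => h i j)).
    have -> : g1 = \sum_j (v 0 j \*: (fun s : R => p j (x + s *: v))).
      by apply/funext => s; rewrite /g1 fct_sumE.
    by apply: is_derive_sum => j; exact: is_deriveZ.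
  - by rewrite /g scale0r addr0; exact: (near_dir (fun y => f y <= f x)).
  - split=> //; rewrite -[RHS]g10 /g1.
    by apply: eq_bigr => i _; rewrite scale0r addr0.
split=> [i|xi].
  have [+ _] := key (delta_mx 0 i); rewrite (bigD1 i)//= mxE !eqxx mul1r.
  rewrite big1 ?addr0// => j ji.
  by rewrite mxE (negbTE ji) andbF mul0r.
have [_] := key xi; rewrite /quadform mxE; congr (_ <= _).
apply: eq_bigr => j _; rewrite !mxE mulrC; congr (_ * _).
by apply: eq_bigr => i _; rewrite mxE.
Qed.

Lemma dotvv_ge0 (R : realType) n (v : 'rV[R]_n) : 0 <= dotv v v.
Proof. by apply: sumr_ge0 => i _; rewrite -expr2 sqr_ge0. Qed.

Lemma enorm_ge0 (R : realType) n (v : 'rV[R]_n) : 0 <= enorm v.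
Proof. exact: sqrtr_ge0. Qed.

Lemma enorm_sqr (R : realType) n (v : 'rV[R]_n) : enorm v ^+ 2 = dotv v v.
Proof. by rewrite sqr_sqrtr// dotvv_ge0. Qed.

Lemma dotvv_eq0 (R : realType) n (v : 'rV[R]_n) : (dotv v v == 0) = (v == 0).
Proof.
apply/idP/eqP => [|->]; last by rewrite /dotv big1// => i _; rewrite mxE mul0r.
rewrite psumr_eq0 => [/allP v0|i _]; last by rewrite -expr2 sqr_ge0.
apply/rowP => i; have := v0 i (mem_index_enum i).
by rewrite /= -expr2 sqrf_eq0 mxE => /eqP.
Qed.

Lemma ler_dotv (R : realType) n (v w : 'rV[R]_n) :
  `|dotv v w| <= enorm v * enorm w.
Proof.
have [/eqP|w0] := eqVneq (dotv w w) 0.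
  rewrite dotvv_eq0 => /eqP ->.
  rewrite {1}/dotv big1 ?normr0 ?mulr_ge0 ?enorm_ge0// => i _.
  by rewrite mxE mulr0.
have c_gt0 : 0 < dotv w w by rewrite lt_neqAle eq_sym w0 dotvv_ge0.
rewrite -(ler_pXn2r (_ : 0 < 2)%N)// ?nnegrE ?mulr_ge0 ?enorm_ge0//.
rewrite exprMn !enorm_sqr real_normK ?num_real//.
(* Up to the factor [dotv w w], this is the component of [v] orthogonal to [w]; its squared length
   gives the Cauchy-Schwarz inequality. *)
have := dotvv_ge0 (dotv w w *: v - dotv v w *: w).
have -> : dotv (dotv w w *: v - dotv v w *: w) (dotv w w *: v - dotv v w *: w) =
    dotv w w * (dotv v v * dotv w w - dotv v w ^+ 2).
  have expand c b : dotv (c *: v - b *: w) (c *: v - b *: w) =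
      c ^+ 2 * dotv v v - 2 * c * b * dotv v w + b ^+ 2 * dotv w w.
    rewrite /dotv !mulr_sumr -sumrB -big_split/=.
    by apply: eq_bigr => i _; rewrite !mxE; ring.
  by rewrite expand; ring.
by rewrite pmulr_rge0// subr_ge0.
Qed.

(** Only earlier times are compared, since the maximum over a time interval may sit at its right
    end; hence an inequality instead of a vanishing derivative. *)
Lemma derive_left_max (R : realType) (g : R -> R) (t d : R) :
  is_derive t 1 g d -> (\forall s \near t, s < t -> g s <= g t) -> 0 <= d.
Proof.
move=> [dg gE] /near_norm[r r0 gmax]; rewrite leNgt; apply/negP => d0.
have : h^-1 *: ((g \o shift t) (h *: 1) - g t) @[h --> 0^'] --> d.
  by rewrite -gE; exact: dg.
move=> /(cvgr_lt d) - /(_ _ d0) => /near_norm[r2 r20 H].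
pose h := - (Num.min r r2 / 2).
have m0 : 0 < Num.min r r2 by rewrite lt_min r0.
have [h0 hr hr2] : [/\ h < 0, - r < h & - r2 < h].
  have [? ?] : Num.min r r2 <= r /\ Num.min r r2 <= r2 by rewrite !ge_min !lexx orbT.
  by rewrite /h; split; lra.
have /(_ _ (ltr0_neq0 h0))/= := H h; rewrite subr0 ltr0_norm// ltrNl.
move=> /(_ hr2); rewrite /shift /= [h *: 1]mulr1 /GRing.scale /=.
rewrite nmulr_rlt0 ?invr_lt0// subr_gt0 ltNge => /negP; apply.
apply: gmax; last by rewrite gtrDr.
by rewrite addrK ltr0_norm// ltrNl.
Qed.

(** * Cylinders, compactness and elementary derivatives *)

Lemma open_cylinder (R : realType) n (U : set 'rV[R]_n) :
  open U -> open (cylinder U).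
Proof.
move=> Uo; rewrite openE => -[x t] [Ux t0].
exists (U, [set` `]0, +oo[]) => //=; split=> /=; first exact: open_nbhs_nbhs.
by apply: open_nbhs_nbhs; split=> //; exact: interval_open.
Qed.

Lemma cylinderE (R : realType) n (U : set 'rV[R]_n) x t :
  cylinder U (x, t) <-> U x /\ 0 < t.
Proof. by rewrite /cylinder /= in_itv /= andbT. Qed.

Lemma ccylinderE (R : realType) n (U : set 'rV[R]_n) x t :
  ccylinder U (x, t) <-> closure U x /\ 0 <= t.
Proof. by rewrite /ccylinder /= in_itv /= andbT. Qed.

Lemma is_derive_affine (R : realType) (a k t : R) :
  is_derive t 1 (fun s : R => a * s + k) a.
Proof.
rewrite (_ : (fun s : R => _) = a \*: (@id R) + cst k); last exact/funext.
by apply: is_derive_eq; rewrite addr0 /GRing.scale /= mulr1.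
Qed.

Lemma is_derive_expR_coord (R : realType) n (i0 i : 'I_n) (lam c : R)
    (y : 'rV[R]_n) :
  is_derive y (delta_mx 0 i) (fun y : 'rV[R]_n => expR (lam * y 0 i0 + c))
    (lam * (i == i0)%:R * expR (lam * y 0 i0 + c)).
Proof.
rewrite -[y in is_derive y]addr0 -(scale0r (delta_mx 0 i : 'rV[R]_n)).
apply/is_derive_lineP.
have -> : (fun t => expR (lam * (y + t *: delta_mx 0 i) 0 i0 + c)) =
    expR \o (fun t => lam * (i == i0)%:R * t + (lam * y 0 i0 + c)).
  apply/funext => t; rewrite /= !mxE eqxx [i0 == i]eq_sym /=; congr expR.
  by ring.
rewrite [X in is_derive _ _ _ X]mulrC.
apply: is_derive1_comp; last exact: is_derive_affine.
by rewrite mulr0 add0r; exact: is_derive_expR.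
Qed.

Lemma closure_norm_le (R : realType) (V : normedModType R) (A : set V) (M : R) :
  (forall y, A y -> `|y| <= M) -> forall y, closure A y -> `|y| <= M.
Proof.
move=> AM y Ay; rewrite leNgt; apply/negP => My.
have r0 : 0 < `|y| - M by rewrite subr_gt0.
have [z [Az]] := Ay _ (nbhsx_ballx y _ r0).
rewrite -ball_normE /ball_ /= => yz.
have := AM _ Az; have := ler_normD (y - z) z; rewrite subrK; lra.
Qed.

Lemma bounded_setP (R : realType) (V : normedModType R) (A : set V) :
  bounded_set A -> exists2 M : R, 0 < M & forall y, A y -> `|y| <= M.
Proof.
case=> M [_ H]; exists (Num.max 0 M + 1).
  by rewrite ltr_wpDl// le_max lexx.
by move=> y Ay; apply: H => //; rewrite ltr_pwDr// le_max lexx orbT.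
Qed.

Lemma compact_closure_bounded (R : realType) n (U : set 'rV[R]_n) :
  bounded_set U -> compact (closure U).
Proof.
move=> /bounded_setP[M M0 UM]; apply: bounded_closed_compact; last first.
  exact: closed_closure.
exists M; split; first exact: num_real.
by move=> r Mr y /(closure_norm_le UM) yM; rewrite /= (le_trans yM)// ltW.
Qed.

(** * The barrier and the comparison principle *)

(** When [Phi] is a primitive of the bound for the right-hand side, it pays for that term; the slope
    [eps] makes the supersolution strict and is later sent to 0. All additive constants are
    collected in [c], and all factors of the exponential in [q]. *)
Definition barrier (R : realType) n (i0 : 'I_n) (Phi : R -> R)
    (c eps q lam kap : R) (p : 'rV[R]_n * R) : R :=
  c + Phi p.2 + eps * p.2 - q * expR (lam * p.1 0 i0 + kap * p.2).

Lemma barrier_continuous (R : realType) n (i0 : 'I_n) (Phi : R -> R)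
    (c eps q lam kap : R) (C : set 'rV[R]_n) (D : set R) :
  {within D, continuous Phi} ->
  {within C `*` D, continuous (barrier i0 Phi c eps q lam kap)}.
Proof.
move=> cP; have cPhi := (subspace_continuousP _ _).1 cP.
apply: (subspace_continuousP _ _).2 => -[x t] /= [Cx Dt].
pose F := within (C `*` D) (nbhs (x, t)).
have c2 : (fun p : 'rV[R]_n * R => p.2) @ F --> t.
  by apply: cvg_within_filter; exact: cvg_snd.
(* [Phi] is continuous only relative to [D], so the time coordinate has to converge inside [D]. *)
have c2' : (fun p : 'rV[R]_n * R => p.2) @ F --> within D (nbhs t).
  move=> Q QD; have H : F [set p : 'rV[R]_n * R | D p.2 -> Q p.2] := c2 _ QD.
  have FA : F (C `*` D) by exact: withinT.
  by apply: (filterS _ (filterI H FA)) => p [Hp [_ Dp]]; exact: Hp.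
have c1 : (fun p : 'rV[R]_n * R => p.1 0 i0) @ F --> x 0 i0.
  apply: cvg_within_filter.
  apply: (@cvg_comp _ _ _ fst (fun y : 'rV[R]_n => y 0 i0)).
    exact: cvg_fst.
  exact: coord_continuous.
suff : (fun p : 'rV[R]_n * R => c + Phi p.2 + eps * p.2 -
      q * expR (lam * p.1 0 i0 + kap * p.2)) @ F -->
    c + Phi t + eps * t - q * expR (lam * x 0 i0 + kap * t) by [].
apply: cvgB.
  apply: cvgD; last by apply: cvgM => //; exact: cvg_cst.
  apply: cvgD; first exact: cvg_cst.
  exact: cvg_comp c2' (cPhi _ Dt).
apply: cvgM; first exact: cvg_cst.
apply: (@cvg_comp _ _ _
  (fun p : 'rV[R]_n * R => lam * p.1 0 i0 + kap * p.2) expR);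
  last exact: continuous_expR.
by apply: cvgD; apply: cvgM => //; exact: cvg_cst.
Qed.

Lemma dt_max (R : realType) n (w : 'rV[R]_n * R -> R) (i0 : 'I_n) (Phi : R -> R)
    (c eps q lam kap a dPhi t : R) y :
  a < t -> tderivable w (y, t) -> is_derive t 1 Phi dPhi ->
  (forall s, a < s <= t -> w (y, s) - barrier i0 Phi c eps q lam kap (y, s) <=
     w (y, t) - barrier i0 Phi c eps q lam kap (y, t)) ->
  dPhi + eps - q * kap * expR (lam * y 0 i0 + kap * t) <= dt w (y, t).
Proof.
move=> at_ dw dP wmax.
have dE : is_derive t 1 (fun s => expR (lam * y 0 i0 + kap * s))
    (expR (lam * y 0 i0 + kap * t) * kap).
  rewrite (_ : (fun s => _) = expR \o (fun s => kap * s + lam * y 0 i0)).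
    apply: is_derive1_comp; last exact: is_derive_affine.
    by rewrite addrC; exact: is_derive_expR.
  by apply/funext => s; rewrite /= addrC.
have dwt : is_derive t 1 (fun s => w (y, s)) (dt w (y, t)).
  by split => //; exact: dw.
have dV : is_derive t 1 (fun s => barrier i0 Phi c eps q lam kap (y, s))
    (dPhi + eps - q * (expR (lam * y 0 i0 + kap * t) * kap)).
  rewrite (_ : (fun s => _) = (Phi + (fun s => eps * s + c)) -
      q \*: (fun s => expR (lam * y 0 i0 + kap * s))).
    have := is_derive_affine eps c t => dl; exact: is_deriveB.
  apply/funext => s; transitivity (Phi s + (eps * s + c) -
    q * expR (lam * y 0 i0 + kap * s)); last by [].
  by rewrite /barrier /=; ring.
have := derive_left_max (is_deriveB dwt dV) _.
rewrite subr_ge0 => H; rewrite -mulrA [kap * _]mulrC; apply: H.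
near=> s; move=> st; rewrite !fctE; apply: wmax; rewrite (ltW st) andbT.
by near: s; exact: lt_nbhsr.
Unshelve. all: by end_near. Qed.

(** At fixed time the barrier varies only through its exponential, so [w] plus [q] times that
    exponential has a maximum at [y]; [partials_max] applies to this sum. *)
Lemma dx_max (R : realType) n (U : set 'rV[R]_n) (w : 'rV[R]_n * R -> R)
    (i0 : 'I_n) (Phi : R -> R) (c eps q lam kap t : R) (y : 'rV[R]_n) :
  open U -> C21 (cylinder U) w -> U y -> 0 < t ->
  (forall y', U y' -> w (y', t) - barrier i0 Phi c eps q lam kap (y', t) <=
     w (y, t) - barrier i0 Phi c eps q lam kap (y, t)) ->
  let E := expR (lam * y 0 i0 + kap * t) in
  grad w (y, t) = - (q * lam * E) *: delta_mx 0 i0 /\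
  forall xi, quadform (hess w (y, t) + (q * lam ^+ 2 * E) *: delta_mx i0 i0) xi <= 0.
Proof.
move=> Uo [_ _ w1 w2] Uy t0 wmax.
pose Ey (y : 'rV[R]_n) := expR (lam * y 0 i0 + kap * t).
pose de i y := lam * (i == i0)%:R * Ey y.
have dE i y' : is_derive y' (delta_mx 0 i) Ey (de i y').
  exact: is_derive_expR_coord.
have ddE i j y' : is_derive y' (delta_mx 0 i) (q \*: de j)
    (q * (lam * (j == i0)%:R * de i y')).
  by apply: is_deriveZ; exact: (is_deriveZ (lam * (j == i0)%:R) (dE i y')).
have cE : continuous Ey.
  move=> y'; apply: (@continuous_comp _ _ _
    (fun z : 'rV[R]_n => lam * z 0 i0 + kap * t) expR);
    last exact: continuous_expR.
  apply: (@continuousD _ _ _ (fun z : 'rV[R]_n => lam * z 0 i0) (cst (kap * t))).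
    by apply: continuousM; [exact: cst_continuous|exact: coord_continuous].
  exact: cst_continuous.
have slice (f : 'rV[R]_n * R -> R) y' : U y' ->
    {within cylinder U, continuous f} -> {for y', continuous (fun z => f (z, t))}.
  move=> Uy'; rewrite continuous_open_subspace; last exact: open_cylinder.
  move=> /(_ (y', t)) cf; apply: (@continuous_comp _ _ _ (fun z => (z, t)) f).
    apply: (@cvg_pair _ _ _ (nbhs y') (nbhs y') (nbhs t) _ _ _ id (cst t)).
      exact: cvg_id.
    exact: cvg_cst.
  by apply: cf; rewrite inE; exact/cylinderE.
have inU y' : U y' -> cylinder U (y', t) by move=> ?; exact/cylinderE.
have Unear : \forall y' \near y, U y' by exact: open_nbhs_nbhs.
pose p i y := dx i w (y, t) + q * de i y.
pose h i j y := dx i (dx j w) (y, t) + q * (lam * (j == i0)%:R * de i y).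
have d1 i y' : U y' ->
    is_derive y' (delta_mx 0 i) ((fun y => w (y, t)) + q \*: Ey) (p i y').
  move=> Uy'; have dw : is_derive y' (delta_mx 0 i) (fun y => w (y, t))
      (dx i w (y', t)) := DeriveDef ((w1 i).1 (y', t) (inU _ Uy')) erefl.
  exact: (is_deriveD dw (is_deriveZ q (dE i y'))).
have d2 i j y' : U y' -> is_derive y' (delta_mx 0 i) (p j) (h i j y').
  move=> Uy'; have dw : is_derive y' (delta_mx 0 i) (fun y => dx j w (y, t))
      (dx i (dx j w) (y', t)) := DeriveDef ((w2 i j).1 (y', t) (inU _ Uy')) erefl.
  exact: (is_deriveD dw (ddE i j y')).
have c1 i y' : U y' -> {for y', continuous (p i)}.
  move=> Uy'; apply: (@continuousD _ _ _ (fun y => dx i w (y, t)) (q \*: de i)).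
    exact: slice _ _ Uy' (w1 i).2.
  apply: (@continuousM _ _ (cst q)); first exact: cst_continuous.
  by apply: (@continuousM _ _ (cst _)); [exact: cst_continuous|exact: cE].
have c2 i j : {for y, continuous (h i j)}.
  apply: (@continuousD _ _ _ (fun y => dx i (dx j w) (y, t))
      (fun y => q * (lam * (j == i0)%:R * de i y))).
    exact: slice _ _ Uy (w2 i j).2.
  apply: (@continuousM _ _ (cst q)); first exact: cst_continuous.
  apply: (@continuousM _ _ (cst _)); first exact: cst_continuous.
  by apply: (@continuousM _ _ (cst _)); [exact: cst_continuous|exact: cE].
have fmax : \forall y' \near y, ((fun y => w (y, t)) + q \*: Ey) y' <=
    ((fun y => w (y, t)) + q \*: Ey) y.
  apply: (filterS _ Unear) => y' /wmax; rewrite /barrier /=.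
  suff : w (y', t) - (c + Phi t + eps * t - q * Ey y') <=
      w (y, t) - (c + Phi t + eps * t - q * Ey y) ->
    w (y', t) + q * Ey y' <= w (y, t) + q * Ey y by exact.
  by lra.
have [p0 hneg] : (forall i, p i y = 0) /\
    forall xi, quadform (\matrix_(i, j) h i j y) xi <= 0.
  apply: (@partials_max R n ((fun y => w (y, t)) + q \*: Ey) y p h) => //.
  - by move=> i; apply: (filterS _ Unear) => y'; exact: d1.
  - by move=> i; apply: (filterS _ Unear) => y'; exact: c1.
  - by move=> i j; apply: (filterS _ Unear) => y'; exact: d2.
split.
  apply/rowP => i; rewrite !mxE eqxx /=; have := p0 i; rewrite /p /de /Ey.
  rewrite [i == i0]eq_sym => /eqP; rewrite addr_eq0 => /eqP ->; ring.
move=> xi; have := hneg xi; congr (quadform _ _ <= _).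
apply/matrixP => i j; rewrite !mxE /h /de /Ey; congr (_ + _).
case: (i == i0); case: (j == i0); rewrite /=; ring.
Qed.

Lemma mxtrace_mul_delta (R : realType) n (A : 'M[R]_n) (i0 : 'I_n) :
  \tr (A *m delta_mx i0 i0) = A i0 i0.
Proof.
rewrite -(mul_delta_mx (0 : 'I_1)) mulmxA mxtrace_mulC mulmxA [\tr _]big_ord1.
by rewrite -rowE -colE !mxE.
Qed.

Lemma quadform_delta (R : realType) n (A : 'M[R]_n) (i0 : 'I_n) :
  quadform A (delta_mx 0 i0) = A i0 i0.
Proof. by rewrite /quadform -rowE trmx_delta -colE !mxE. Qed.

(** The nonlinear operator seen along a given solution: [z] stands for the size of the drift and [k]
    for that of the quadratic coefficient, both evaluated at the solution. What remains depends on
    the gradient only through its length, hence does not see the sign of [w]. *)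
Definition subsolution (R : realType) n (U : set 'rV[R]_n)
    (A : 'rV[R]_n * R -> 'M[R]_n) (z k : 'rV[R]_n * R -> R) (F : R -> R)
    (w : 'rV[R]_n * R -> R) : Prop :=
  forall p, cylinder U p ->
    dt w p - \tr ((A p)^T *m hess w p) <=
    F p.2 + z p * enorm (grad w p) + k p * enorm (grad w p) ^+ 2.

(** A positive maximum of [w - V] cannot lie at time [a] or on the lateral boundary, and elsewhere
    the conditions at a maximum contradict the differential inequality. The hypothesis on the
    coefficients says that [V] is a supersolution, after division by the exponential; the factor [q]
    on both sides makes it trivial for q = 0. *)
Lemma comparison (R : realType) n (U : set 'rV[R]_n)
    (A : 'rV[R]_n * R -> 'M[R]_n) (c0 : R) (z k : 'rV[R]_n * R -> R)
    (F : R -> R) (w : 'rV[R]_n * R -> R) (i0 : 'I_n) (Phi : R -> R)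
    (a b c eps q lam kap : R) :
  open U -> bounded_set U -> U !=set0 ->
  (forall p, cylinder U p -> (A p)^T = A p) -> 0 < c0 ->
  (forall p xi, cylinder U p -> c0 * enorm xi ^+ 2 <= quadform (A p) xi) ->
  {within ccylinder U, continuous w} -> C21 (cylinder U) w ->
  subsolution U A z k F w ->
  0 <= a -> 0 < eps -> 0 <= q -> 0 <= lam ->
  {within `[a, b], continuous Phi} ->
  (forall t, a < t <= b -> is_derive t 1 Phi (F t)) ->
  let V := barrier i0 Phi c eps q lam kap in
  (forall x t, U x -> a < t <= b ->
     q * (kap + z (x, t) * lam +
       k (x, t) * lam ^+ 2 * (q * expR (lam * x 0 i0 + kap * t))) <=
     q * (c0 * lam ^+ 2)) ->
  (forall x t, bdry U x -> a <= t <= b -> w (x, t) <= V (x, t)) ->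
  (forall x, closure U x -> w (x, a) <= V (x, a)) ->
  forall x t, closure U x -> a <= t <= b -> w (x, t) <= V (x, t).
Proof.
move=> Uo Ub [y0 Uy0] Asym c0_gt0 Aell wc w21 wsub a0 eps0 q0 lam0 Phic dPhi V.
move=> coef Vb Va x1 t1 Ux1 t1I.
have ab : a <= b by case/andP: t1I => /le_trans; apply.
pose K := closure U `*` `[a, b].
have Kc : compact K by apply: compact_setX;
  [exact: compact_closure_bounded|exact: segment_compact].
have Kx1 : K (x1, t1) by split=> //=; rewrite in_itv.
have wK : {within K, continuous (w - V)}.
  apply: within_continuousB; last exact: barrier_continuous.
  apply: continuous_subspaceW wc => -[x t] [/= Ux]; rewrite in_itv /=.
  by move=> /andP[at_ _]; apply/ccylinderE; split=> //; exact: le_trans at_.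
have [|[y t] + ymax] := compact_EVT_max _ Kc wK; first by exists (x1, t1).
rewrite inE => -[/= Uy]; rewrite in_itv /= => /andP[at_ tb].
have {}ymax x s : closure U x -> a <= s <= b ->
    w (x, s) - V (x, s) <= w (y, t) - V (y, t).
  by move=> Ux sI; apply: (ymax (x, s)); rewrite inE; split=> //=; rewrite in_itv.
suff wV : w (y, t) <= V (y, t) by have := ymax _ _ Ux1 t1I; lra.
rewrite leNgt; apply/negP => Vw.
have {at_} at_ : a < t.
  rewrite lt_neqAle at_ andbT; apply/eqP => ta; move: Vw.
  by rewrite ltNge -ta Va.
have tI : a <= t <= b by rewrite ltW.
have {}Uy : U y.
  apply: contrapT => nUy; move: Vw; rewrite ltNge Vb//; split=> // Uiy.
  by apply: nUy; exact: interior_subset.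
have Uc x : U x -> closure U x by exact: subset_closure.
have t0 : 0 < t by exact: le_lt_trans at_.
have cyl : cylinder U (y, t) by exact/cylinderE.
have wderiv : tderivable w (y, t) by case: w21 => _ [dw _] _ _; exact: dw.
have atb : a < t <= b by rewrite at_.
have dtw : F t + eps - q * kap * expR (lam * y 0 i0 + kap * t) <= dt w (y, t).
  apply: (dt_max (c := c) at_ wderiv (dPhi _ atb)) => s /andP[as_ st].
  by apply: ymax; [exact: Uc|rewrite ltW//= (le_trans st)].
have := @dx_max R n U w i0 Phi c eps q lam kap t y Uo w21 Uy t0.
set E := expR _ => -[y' Uy'|gradE hessN].
  by apply: ymax => //; exact: Uc.
have E0 : 0 < E by exact: expR_gt0.
(* The Hessian of the barrier has a single entry, so its trace against [A] is the diagonal entry at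
   [i0], at least [c0] by ellipticity at a unit vector. *)
have trA : \tr ((A (y, t))^T *m hess w (y, t)) <= - (q * lam ^+ 2 * E) * c0.
  have := mxtrace_posdef_nsd (Asym _ cyl) _ hessN.
  rewrite mulmxDr mxtraceD -scalemxAr mxtraceZ mxtrace_mul_delta Asym//.
  have := Aell _ (delta_mx 0 i0) cyl; rewrite quadform_delta enorm_sqr.
  rewrite /dotv (bigD1 i0)//= big1 => [|i /negbTE i_i0]; last first.
    by rewrite mxE i_i0 andbF mul0r.
  rewrite mxE !eqxx mulr1 addr0 mulr1 => cA trle.
  have {}trle : \tr (A (y, t) *m hess w (y, t)) +
      q * lam ^+ 2 * E * A (y, t) i0 i0 <= 0.
    apply: trle => xi xi0; apply: lt_le_trans (Aell _ xi cyl).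
    by rewrite mulr_gt0// enorm_sqr lt_neqAle eq_sym dotvv_eq0 xi0 dotvv_ge0.
  have : q * lam ^+ 2 * E * c0 <= q * lam ^+ 2 * E * A (y, t) i0 i0.
    by rewrite ler_wpM2l// mulr_ge0// ?(ltW E0)// mulr_ge0// sqr_ge0.
  by lra.
have gE : enorm (grad w (y, t)) = q * lam * E.
  rewrite /enorm gradE /dotv (bigD1 i0)//= big1 => [|i /negbTE i_i0]; last first.
    by rewrite !mxE i_i0 andbF mulr0 mul0r.
  rewrite !mxE !eqxx mulr1 addr0 mulrNN -expr2 sqrtr_sqr ger0_norm//.
  by rewrite !mulr_ge0// ltW.
(* Everything but [eps] cancels or has the right sign once the coefficient condition is multiplied
   by [E]; what is left is eps <= 0. *)
have := wsub _ cyl; rewrite gE /=.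
have := ler_wpM2r (ltW E0) (coef _ _ Uy atb); rewrite -/E.
set T := \tr _ in trA *; set D := dt _ _ in dtw *.
move: dtw; rewrite -/E; lra.
Qed.

(** * Maximum principle and decay over one unit of time *)

Lemma le_of_slope (R : realType) (x y s : R) :
  0 <= s -> (forall eps, 0 < eps -> x <= y + eps * s) -> x <= y.
Proof.
move=> s0 H; apply/ler_addgt0Pr => e e0.
have es : 0 < e / (s + 1) by rewrite divr_gt0// ltr_wpDl.
rewrite (le_trans (H _ es))// lerD2l mulrAC ler_pdivrMr ?ltr_wpDl//.
by rewrite ler_wpM2l ?lerDl// ltW.
Qed.

(** The comparison with q = 0: the barrier is m + Phi t - Phi a + eps (t - a), and [eps] tends to
    0. *)
Lemma weak_max_principle (R : realType) n (U : set 'rV[R]_n)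
    (A : 'rV[R]_n * R -> 'M[R]_n) (c0 : R) (z k : 'rV[R]_n * R -> R)
    (F : R -> R) (w : 'rV[R]_n * R -> R) (Phi : R -> R) (a b m : R) :
  (0 < n)%N -> open U -> bounded_set U -> U !=set0 ->
  (forall p, cylinder U p -> (A p)^T = A p) -> 0 < c0 ->
  (forall p xi, cylinder U p -> c0 * enorm xi ^+ 2 <= quadform (A p) xi) ->
  {within ccylinder U, continuous w} -> C21 (cylinder U) w ->
  subsolution U A z k F w -> 0 <= a ->
  {within `[a, b], continuous Phi} ->
  (forall t, a < t <= b -> is_derive t 1 Phi (F t)) ->
  (forall t, a <= t <= b -> Phi a <= Phi t) ->
  (forall x t, bdry U x -> a <= t <= b -> w (x, t) <= m) ->
  (forall x, closure U x -> w (x, a) <= m) ->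
  forall x t, closure U x -> a <= t <= b -> w (x, t) <= m + (Phi t - Phi a).
Proof.
move=> n0 Uo Ub U0 Asym c0_gt0 Aell wc w21 wsub a0 Phic dPhi Phia wb wa x t Ux tI.
have ta : 0 <= t - a by rewrite subr_ge0; case/andP: tI.
apply: (le_of_slope ta) => eps eps0.
have := @comparison R n U A c0 z k F w (Ordinal n0) Phi a b (m - Phi a - eps * a)
  eps 0 0 0 Uo Ub U0 Asym c0_gt0 Aell wc w21 wsub a0 eps0 (lexx _) (lexx _)
  Phic dPhi.
rewrite /barrier /= => /(_ _ _ _ x t Ux tI) H.
suff : w (x, t) <= m - Phi a - eps * a + Phi t + eps * t -
    0 * expR (0 * x 0 (Ordinal n0) + 0 * t) by lra.
apply: H => [y s _ _|y s Uy sI|y Uy]; first by rewrite !mul0r.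
  have := wb _ _ Uy sI; have := Phia _ sI; have : 0 <= eps * (s - a).
    by rewrite mulr_ge0 ?(ltW eps0)// subr_ge0; case/andP: sI.
  by lra.
by have := wa _ Uy; lra.
Qed.

(* Half of the ellipticity absorbs the drift and the growth of the barrier in
   time; the first factor of [decay_rate] leaves the other half for the quadratic
   gradient term. *)
Definition steepness (R : realType) (c0 D zeta : R) : R :=
  2 * (zeta + 2 * D + 1) / c0 + 1.

Definition decay_rate (R : realType) (c0 D M kk zeta : R) : R :=
  c0 / (2 * kk * M + c0) * expR (- (steepness c0 D zeta * (2 * D + 1))).

(** The exponential is at most 1 at time [a], so the barrier starts above [m]; [dlt] times it never
    exceeds 1, so the barrier stays above [beta] on the lateral boundary; and it is at least 2
    everywhere at time a + 1, which turns m (1 + dlt) into at most m (1 - dlt). *)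
Lemma growth (R : realType) n (U : set 'rV[R]_n)
    (A : 'rV[R]_n * R -> 'M[R]_n) (c0 : R) (z k : 'rV[R]_n * R -> R)
    (F : R -> R) (w : 'rV[R]_n * R -> R) (Phi : R -> R)
    (a beta m M D kk zeta : R) :
  (0 < n)%N -> open U -> U !=set0 ->
  (forall x, U x -> `|x| <= D) ->
  (forall p, cylinder U p -> (A p)^T = A p) -> 0 < c0 ->
  (forall p xi, cylinder U p -> c0 * enorm xi ^+ 2 <= quadform (A p) xi) ->
  {within ccylinder U, continuous w} -> C21 (cylinder U) w ->
  subsolution U A z k F w -> 0 <= a ->
  {within `[a, a + 1], continuous Phi} ->
  (forall t, a < t <= a + 1 -> is_derive t 1 Phi (F t)) ->
  (forall t, a <= t <= a + 1 -> Phi a <= Phi t) ->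
  0 <= beta -> 0 <= m <= M -> 0 <= kk -> 0 <= zeta ->
  (forall x t, U x -> a < t <= a + 1 -> z (x, t) <= zeta /\ k (x, t) <= kk) ->
  (forall x t, bdry U x -> a <= t <= a + 1 -> w (x, t) <= beta) ->
  (forall x, closure U x -> w (x, a) <= m) ->
  forall x, closure U x -> w (x, a + 1) <=
    beta + (Phi (a + 1) - Phi a) + m * (1 - decay_rate c0 D M kk zeta).
Proof.
move=> n0 Uo U0 UD Asym c0_gt0 Aell wc w21 wsub a0 Phic dPhi Phia beta0.
move=> /andP[m0 mM] kk0 zeta0 zk wb wa x Ux.
have D0 : 0 <= D by case: U0 => y /UD; exact: le_trans.
pose i0 := Ordinal n0.
have coordD y : closure U y -> - D <= y 0 i0 <= D.
  move=> /(closure_norm_le UD) yD; rewrite -ler_norml; apply: le_trans yD.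
  rewrite [leRHS]/Num.Def.normr /= mx_normrE.
  exact: (le_bigmax _ (fun ij : 'I_1 * 'I_n => `|y ij.1 ij.2|) (0, i0)).
set lam := steepness c0 D zeta; pose kap := lam * (2 * D + 1).
set dlt := decay_rate c0 D M kk zeta; pose e0 := c0 / (2 * kk * M + c0).
have dltE : dlt = e0 * expR (- kap) by [].
have M0 : 0 <= M by exact: le_trans mM.
have den0 : 0 < 2 * kk * M + c0 by rewrite ltr_wpDl// !mulr_ge0.
have e0_gt0 : 0 < e0 by rewrite divr_gt0.
have e0_le1 : e0 <= 1 by rewrite ler_pdivrMr// mul1r lerDr !mulr_ge0.
(* Since [q] times the exponential will be at most M e0, the quadratic term consumes at most half of
   the ellipticity. *)
have kMe : kk * M * e0 <= c0 / 2.
  have -> : kk * M * e0 = c0 * (kk * M) / (2 * kk * M + c0) by rewrite /e0; ring.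
  rewrite ler_pdivrMr//.
  have -> : c0 / 2 * (2 * kk * M + c0) = c0 * (kk * M) + c0 ^+ 2 / 2 by field.
  by rewrite lerDl divr_ge0// sqr_ge0.
(* The final 1 in [steepness] is there for this: it gives exp lam >= 1 + lam >= 2 below. *)
have lam1 : 1 <= lam.
  by rewrite lerDr divr_ge0 ?(ltW c0_gt0)// mulr_ge0// !addr_ge0// mulr_ge0.
have lam0 : 0 < lam by exact: lt_le_trans lam1.
have lamc : zeta + 2 * D + 1 <= lam * c0 / 2.
  have -> : lam * c0 / 2 = zeta + 2 * D + 1 + c0 / 2.
    by rewrite /lam /steepness; field; rewrite gt_eqF.
  by lra.
have kap0 : 0 <= kap by rewrite mulr_ge0// ?(ltW lam0)// addr_ge0// mulr_ge0.
have dlt0 : 0 <= dlt by rewrite dltE mulr_ge0 ?expR_ge0// ltW.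
(* Normalised so that the exponent becomes lam (x1 - D) + kap (t - a), as recorded in [qE]. *)
pose q := m * dlt * expR (- (lam * D) - kap * a).
have qE y t : q * expR (lam * y 0 i0 + kap * t) =
    m * (dlt * expR (lam * (y 0 i0 - D) + kap * (t - a))).
  by rewrite /q -[LHS]mulrA -expRD -[LHS]mulrA; congr (_ * (_ * expR _)); ring.
have dltE_le y t : closure U y -> t <= a + 1 ->
    dlt * expR (lam * (y 0 i0 - D) + kap * (t - a)) <= e0.
  move=> /coordD/andP[_ yD] ta; rewrite dltE -mulrA -expRD.
  rewrite ler_piMr ?(ltW e0_gt0)// -expR0 ler_expR.
  have : lam * (y 0 i0 - D) <= 0 by rewrite pmulr_rle0// subr_le0.
  have : kap * (t - a) <= kap by rewrite ler_piMr// lerBlDl.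
  by lra.
apply: (le_of_slope ler01) => eps eps0.
have := @comparison R n U A c0 z k F w i0 Phi a (a + 1)
  (beta - Phi a - eps * a + m * (1 + dlt)) eps q lam kap Uo _ U0 Asym c0_gt0 Aell
  wc w21 wsub a0 eps0 _ (ltW lam0) Phic dPhi.
rewrite /barrier /= => /(_ _ _ _ _ _ x (a + 1) Ux) H.
have Ub : bounded_set U.
  exists D; split; first exact: num_real.
  by move=> r Dr y /UD yD; rewrite /= (le_trans yD)// ltW.
have q0 : 0 <= q by apply: mulr_ge0; [exact: mulr_ge0|exact: expR_ge0].
have {H} := H Ub q0; rewrite qE => H.
have : w (x, a + 1) <= beta - Phi a - eps * a + m * (1 + dlt) + Phi (a + 1) +
    eps * (a + 1) - m * (dlt * expR (lam * (x 0 i0 - D) + kap * (a + 1 - a))).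
  apply: H => [y t Uy tI|y t Uy tI|y Uy|]; last by rewrite lerDl ler01 lexx.
  (* The supersolution condition: kap + zeta lam = (zeta + 2 D + 1) lam is paid by one half of c0
     lam^2 through [lamc], the quadratic term by the other half through [kMe]. *)
  - rewrite ler_wpM2l// qE.
    have [zl kl] := zk _ _ Uy tI; have /andP[_ t1] := tI.
    have := dltE_le _ _ (subset_closure Uy) t1.
    have : 0 <= dlt * expR (lam * (y 0 i0 - D) + kap * (t - a)).
      by rewrite mulr_ge0// expR_ge0.
    set s := dlt * _ => s0 se.
    have ms0 : 0 <= m * s by rewrite mulr_ge0.
    have ms : m * s <= M * e0 by apply: ler_pM.
    have h1 : k (y, t) * lam ^+ 2 * (m * s) <= c0 / 2 * lam ^+ 2.
      rewrite mulrAC ler_wpM2r ?sqr_ge0//.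
      apply: (@le_trans _ _ (kk * (m * s))); first exact: ler_wpM2r.
      by apply: le_trans kMe; rewrite -mulrA ler_wpM2l.
    have h2 : z (y, t) * lam <= zeta * lam by rewrite ler_wpM2r// ltW.
    have h3 : (zeta + 2 * D + 1) * lam <= lam * c0 / 2 * lam.
      by rewrite ler_wpM2r// ltW.
    by rewrite /kap; lra.
  - rewrite qE; have /andP[ta t1] := tI.
    have := dltE_le _ _ Uy.1 t1; set s := dlt * _ => se.
    have : 0 <= m * (1 + dlt - s) by rewrite mulr_ge0//; lra.
    have : 0 <= eps * (t - a) by rewrite mulr_ge0 ?(ltW eps0)// subr_ge0.
    by have := wb _ _ Uy tI; have := Phia _ tI; lra.
  - rewrite qE subrr mulr0 addr0.
    have /andP[_ yD] := coordD _ Uy.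
    have e1 : expR (lam * (y 0 i0 - D)) <= 1.
      by rewrite -expR0 ler_expR pmulr_rle0// subr_le0.
    have : m * (dlt * expR (lam * (y 0 i0 - D))) <= m * dlt.
      by rewrite ler_wpM2l// ler_piMr.
    by have := wa _ Uy; lra.
have /andP[xD _] := coordD _ Ux.
(* The spatial part of the exponent is at least - 2 D lam, and kap = lam (2 D + 1) outweighs it by
   [lam]. *)
have e2 : 2 <= expR (lam * (x 0 i0 - D) + kap * (a + 1 - a)).
  have h : lam <= lam * (x 0 i0 - D) + kap * (a + 1 - a).
    rewrite addrAC subrr add0r mulr1 /kap -mulrDr ler_peMr ?(ltW lam0)//; lra.
  have := expR_ge1Dx lam.
  have : expR lam <= expR (lam * (x 0 i0 - D) + kap * (a + 1 - a)).
    by rewrite ler_expR.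
  by lra.
have : m * (dlt * 2) <= m * (dlt * expR (lam * (x 0 i0 - D) + kap * (a + 1 - a))).
  by rewrite !ler_wpM2l.
by lra.
Qed.

(** * Integrals over segments and rays, and divergence of sums *)

Lemma integrable_itvcc (R : realType) (f : R -> R) (a b : R) :
  {within `[0, +oo[, continuous f} -> 0 <= a ->
  lebesgue_measure.-integrable `[a, b] (EFin \o f).
Proof.
move=> fc a0; apply: continuous_compact_integrable; first exact: segment_compact.
apply: continuous_subspaceW fc => x /=; rewrite !in_itv /= andbT => /andP[ax _].
exact: le_trans ax.
Qed.

Lemma Rintegral_split (R : realType) (f : R -> R) (a x b : R) :
  {within `[0, +oo[, continuous f} -> 0 <= a -> a <= x <= b ->
  \int[lebesgue_measure]_(s in `[a, b]) f s =
  \int[lebesgue_measure]_(s in `[a, x]) f s +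
  \int[lebesgue_measure]_(s in `[x, b]) f s.
Proof.
move=> fc a0 /andP[ax xb]; apply/eqP; rewrite addrC -subr_eq; apply/eqP.
rewrite Rintegral_itvB ?bnd_simp//; last exact: integrable_itvcc.
apply: Rintegral_itv_obnd_cbnd.
apply: integrableS (integrable_itvcc b fc (le_trans a0 ax)) => //.
by apply: subset_itvr; rewrite bnd_simp.
Qed.

Lemma Rintegral_itv_le (R : realType) (f : R -> R) (a b C : R) :
  {within `[0, +oo[, continuous f} -> 0 <= a -> a <= b ->
  (forall s, a <= s <= b -> f s <= C) ->
  \int[lebesgue_measure]_(s in `[a, b]) f s <= C * (b - a).
Proof.
move=> fc a0 ab fC.
have -> : C * (b - a) = \int[lebesgue_measure]_(s in `[a, b]) C.
  rewrite Rintegral_cst//= lebesgue_measure_itv /= lte_fin.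
  by case: ltgtP ab => // -> _; rewrite subrr.
apply: le_Rintegral => //; first exact: integrable_itvcc.
by apply: integrable_itvcc => // x; exact: cvg_cst.
Qed.

Lemma Rintegral_itv_ge0 (R : realType) (f : R -> R) (a b : R) :
  (forall s, 0 <= s -> 0 <= f s) -> 0 <= a ->
  0 <= \int[lebesgue_measure]_(s in `[a, b]) f s.
Proof.
move=> f0 a0; apply: Rintegral_ge0 => s /=; rewrite in_itv /= => /andP[as_ _].
by apply: f0; exact: le_trans as_.
Qed.

Lemma measurable_fun_ray (R : realType) (f : R -> R) (a : R) :
  {within `[0, +oo[, continuous f} -> 0 <= a ->
  measurable_fun (`[a, +oo[%classic : set (measurableTypeR R))
    (f : _ -> measurableTypeR R).
Proof.
move=> fc a0; apply: subspace_continuous_measurable_fun => //.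
by apply: continuous_subspaceW fc; apply: subset_itvr; rewrite bnd_simp.
Qed.

Lemma Rintegral_itv_le_ray (R : realType) (f : R -> R) (t : R) :
  {within `[0, +oo[, continuous f} -> (forall s, 0 <= s -> 0 <= f s) ->
  (\int[lebesgue_measure]_(s in `[0%R, +oo[) (f s)%:E < +oo)%E ->
  \int[lebesgue_measure]_(s in `[0, t]) f s <=
  fine (\int[lebesgue_measure]_(s in `[0%R, +oo[) (f s)%:E).
Proof.
move=> fc f0 foo; have f0' x : `[0, +oo[%classic x -> (0 <= (f x)%:E)%E.
  by rewrite /= in_itv /= andbT lee_fin; exact: f0.
have sub : (`[0, t]%classic : set R) `<=` `[0, +oo[%classic.
  by apply: subset_itvl; rewrite bnd_simp.
apply: fine_le; last 1 first.
- apply: ge0_subset_integral => //.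
  by apply/measurable_EFinP; exact: measurable_fun_ray.
- exact: integrable_fin_num (integrable_itvcc _ fc _).
- by rewrite ge0_fin_numE// integral_ge0.
Qed.

(** Monotone convergence along the segments [T, T + k], which exhaust the ray. *)
Lemma primitive_unbounded (R : realType) (g : R -> R) (T X : R) :
  {within `[0, +oo[, continuous g} -> (forall s, 0 <= s -> 0 <= g s) -> 0 <= T ->
  (\int[lebesgue_measure]_(s in `[T, +oo[) (g s)%:E = +oo)%E ->
  exists k : nat, X <= \int[lebesgue_measure]_(s in `[T, T + k%:R]) g s.
Proof.
move=> gc g0 T0 goo; pose S (k : nat) : set R := `[T, T + k%:R]%classic.
have Sray k : S k `<=` `[T, +oo[ by apply: subset_itvl; rewrite bnd_simp.
have SE : \bigcup_k S k = `[T, +oo[%classic.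
  apply/seteqP; split=> [x [k _ /Sray]//|x /=]; rewrite in_itv /= andbT => Tx.
  exists (Num.bound (x - T)) => //; rewrite /S /= in_itv /= Tx /= -lerBlDl ltW//.
  by apply: archi_boundP; rewrite subr_ge0.
have Hoo : (\int[lebesgue_measure]_(s in S k) (g s)%:E)%E @[k --> \oo] --> +oo%E.
  rewrite -goo -SE; apply: ge0_nondecreasing_set_cvg_integral.
  - move=> i j ij; rewrite subsetEset; apply: subset_itvl.
    by rewrite bnd_simp lerD2l ler_nat.
  - by move=> k; exact: measurable_itv.
  - move=> k; apply/measurable_EFinP.
    exact: measurable_funS (Sray k) (measurable_fun_ray gc T0).
  - move=> k x /Sray; rewrite /= in_itv /= andbT lee_fin => Tx.
    by apply: g0; exact: le_trans Tx.
have [k _ /(_ k (leqnn k)) /=] := cvgey_ge Hoo X.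
move=> Xk; exists k; rewrite -lee_fin; apply: le_trans Xk _.
by rewrite fineK// (integrable_fin_num _ (integrable_itvcc _ gc _)).
Qed.

Lemma primitive_derive (R : realType) (F : R -> R) (t : R) :
  {within `[0, +oo[, continuous F} -> 0 < t ->
  is_derive t 1 (fun s => \int[lebesgue_measure]_(x in `[0, s]) F x) (F t).
Proof.
move=> Fc t0; have t1 : t < t + 1 by rewrite ltrDl.
have Ft : {for t, continuous F}.
  apply: (@within_continuous_continuous _ _ _ 0 (t + 1)).
  - by rewrite ltr_wpDl// ltW.
  - by apply: continuous_subspaceW Fc; apply: subset_itvl; rewrite bnd_simp.
  - by rewrite in_itv /= t0 t1.
have [dP PE] := continuous_FTC1_closed t1 (integrable_itvcc _ Fc (lexx 0)) t0 Ft.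
by rewrite -PE derive1E; exact: derivableP.
Qed.

Lemma primitive_continuous (R : realType) (F : R -> R) (a b : R) :
  {within `[0, +oo[, continuous F} -> 0 <= a ->
  {within `[a, b], continuous (fun s => \int[lebesgue_measure]_(x in `[0, s]) F x)}.
Proof.
move=> Fc a0; have [b0|b0] := leP 0 b; last first.
  rewrite set_itv_ge; first exact: continuous_subspace0.
  by rewrite bnd_simp -ltNge (lt_le_trans b0).
have := parameterized_integral_continuous b0 (integrable_itvcc b Fc (lexx 0)).
by apply: continuous_subspaceW; apply: subset_itvr; rewrite bnd_simp.
Qed.

Lemma prodr_1B_le_expR (R : realType) (eta : nat -> R) (k : nat) :
  (forall i, 0 <= eta i <= 1) ->
  \prod_(i < k) (1 - eta i) <= expR (- \sum_(i < k) eta i).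
Proof.
move=> eta01; rewrite -sumrN expR_sum; apply: ler_prod => i _.
have /andP[_ e1] := eta01 i; rewrite subr_ge0 e1 /=.
exact: expR_ge1Dx.
Qed.

Lemma primitive_le_sum (R : realType) (g : R -> R) (a : R) (k : nat) :
  {within `[0, +oo[, continuous g} -> 0 <= a ->
  {in `[0, +oo[ &, {homo g : s t /~ s <= t}} ->
  \int[lebesgue_measure]_(s in `[a, a + k%:R]) g s <= \sum_(i < k) g (a + i%:R).
Proof.
move=> gc a0 gdecr; elim: k => [|k IH].
  by rewrite addr0 big_ord0 set_itv1 Rintegral_set1.
rewrite big_ord_recr/= (@Rintegral_split _ _ _ (a + k%:R))//; last first.
  by rewrite lerDl ler0n lerD2l ler_nat /=.
apply: lerD => //; have ak : 0 <= a + k%:R by rewrite addr_ge0.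
have kS : a + k%:R <= a + k.+1%:R by rewrite lerD2l ler_nat.
have := @Rintegral_itv_le R g (a + k%:R) (a + k.+1%:R) (g (a + k%:R)) gc ak kS.
have -> : a + k.+1%:R - (a + k%:R) = 1 by rewrite -natr1; ring.
rewrite mulr1; apply => s /andP[ks _]; apply: gdecr => //.
  by rewrite in_itv /= andbT (le_trans ak).
by rewrite in_itv /= andbT.
Qed.

Lemma integral_test (R : realType) (g : R -> R) (T S X : R) :
  {within `[0, +oo[, continuous g} -> (forall s, 0 <= s -> 0 <= g s) ->
  {in `[0, +oo[ &, {homo g : s t /~ s <= t}} -> 0 <= T ->
  (\int[lebesgue_measure]_(s in `[T, +oo[) (g s)%:E = +oo)%E -> T <= S ->
  exists N : nat, X <= \sum_(i < N) g (S + i%:R).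
Proof.
move=> gc g0 gdecr T0 goo TS; have S0 : 0 <= S by exact: le_trans TS.
(* The target is raised by the integral over [T, S], which is lost when the sum starts at [S]
   instead of [T]. *)
have [N NX] := primitive_unbounded
  (X + \int[lebesgue_measure]_(s in `[T, S]) g s) gc g0 T0 goo.
exists N; apply: le_trans (primitive_le_sum N gc S0 gdecr).
have i1 : T <= S <= S + N%:R by rewrite TS lerDl ler0n.
have i2 : T <= T + N%:R <= S + N%:R by rewrite lerDl ler0n lerD2r.
have e1 := Rintegral_split gc T0 i1; have e2 := Rintegral_split gc T0 i2.
have : 0 <= \int[lebesgue_measure]_(s in `[(T + N%:R), (S + N%:R)]) g s.
  by apply: Rintegral_itv_ge0; rewrite ?addr_ge0.
by move: NX; rewrite e1 in e2; lra.
Qed.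

(** * Affine changes of the unknown *)

Lemma derivable_scale_shift (R : realType) (V : normedModType R) (f : V -> R)
    (a b : R) (x v : V) :
  derivable f x v -> derivable (fun y => a * f y + b) x v.
Proof.
move=> df; rewrite (_ : (fun y => _) = a \*: f + cst b); last exact/funext.
by apply: derivableD; [exact: derivableZ|exact: derivable_cst].
Qed.

(* For a function that is not derivable both sides are the junk value 0. *)
Lemma derive_scale_shift (R : realType) (V : normedModType R) (f : V -> R)
    (a b : R) (x v : V) :
  a != 0 -> 'D_v (fun y => a * f y + b) x = a * 'D_v f x.
Proof.
move=> a0; have [df|ndf] := pselect (derivable f x v).
  rewrite (_ : (fun y => _) = a \*: f + cst b); last exact/funext.
  rewrite deriveD; [|exact: derivableZ|exact: derivable_cst].
  by rewrite deriveZ// derive_cst addr0.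
have ndg : ~ derivable (fun y => a * f y + b) x v.
  move=> dg; apply: ndf.
  have := @derivable_scale_shift _ _ _ a^-1 (- (a^-1 * b)) x v dg.
  congr (derivable _ x v); apply/funext => y.
  by rewrite mulrDr mulKf// addrK.
have junk (g : V -> R) : ~ derivable g x v -> 'D_v g x = 0.
  by move=> ng; rewrite /derive dvgP; [reflexivity|exact: ng].
by rewrite (junk _ ndf) (junk _ ndg) mulr0.
Qed.

Lemma dt_scale_shift (R : realType) n (u : 'rV[R]_n * R -> R) (a b : R) p :
  a != 0 -> dt (fun p => a * u p + b) p = a * dt u p.
Proof. exact: derive_scale_shift. Qed.

(** An equality of functions, valid also where [u] is not derivable, because second derivatives
    differentiate it again. The added 0 keeps the shape a f + b, so that the same lemmas apply at
    second order. *)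
Lemma dx_scale_shift (R : realType) n (u : 'rV[R]_n * R -> R) (a b : R) i :
  a != 0 -> dx i (fun p => a * u p + b) = (fun p => a * dx i u p + 0).
Proof.
by move=> a0; apply/funext => p; rewrite addr0; exact: derive_scale_shift.
Qed.

Lemma grad_scale_shift (R : realType) n (u : 'rV[R]_n * R -> R) (a b : R) p :
  a != 0 -> grad (fun p => a * u p + b) p = a *: grad u p.
Proof. by move=> a0; apply/rowP => i; rewrite !mxE dx_scale_shift// addr0. Qed.

Lemma hess_scale_shift (R : realType) n (u : 'rV[R]_n * R -> R) (a b : R) p :
  a != 0 -> hess (fun p => a * u p + b) p = a *: hess u p.
Proof.
move=> a0; apply/matrixP => i j; rewrite !mxE dx_scale_shift//.
exact: derive_scale_shift.
Qed.

Lemma within_continuous_scale_shift (R : realType) n (D : set ('rV[R]_n * R))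
    (f : 'rV[R]_n * R -> R) (a b : R) :
  {within D, continuous f} -> {within D, continuous (fun p => a * f p + b)}.
Proof.
move=> cf x; apply: cvgD; last exact: cvg_cst.
by apply: cvgM; [exact: cvg_cst|exact: cf].
Qed.
Lemma C21_scale_shift (R : realType) n (D : set ('rV[R]_n * R)) u (a b : R) :
  a != 0 -> C21 D u -> C21 D (fun p => a * u p + b).
Proof.
move=> a0 [cu [du cdu] ux uxx]; split.
- exact: within_continuous_scale_shift.
- split=> [p Dp|]; first exact: derivable_scale_shift (du _ Dp).
  rewrite (_ : dt _ = fun p => a * dt u p + 0).
    exact: within_continuous_scale_shift.
  by apply/funext => p; rewrite addr0; exact: dt_scale_shift.
- move=> i; have [dux cux] := ux i; split=> [p Dp|].
    exact: derivable_scale_shift (dux _ Dp).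
  by rewrite dx_scale_shift//; exact: within_continuous_scale_shift.
- move=> i j; have [dux cux] := uxx i j; rewrite dx_scale_shift//; split=> [p Dp|].
    exact: derivable_scale_shift (dux _ Dp).
  by rewrite dx_scale_shift//; exact: within_continuous_scale_shift.
Qed.

(** * Using the Range Condition, the diameter and the upper limit *)

(** P' is known to be continuous on J only, so bounding it requires a segment whose endpoints belong
    to J. On a side where J is bounded the Range Condition supplies the endpoint; on an unbounded
    side the bound [M] does, with a maximum or minimum keeping it in J. *)
Lemma range_condition_segment (R : realType) (J E : set R) (M : R) :
  range_condition J E -> (forall y, E y -> `|y| <= M) ->
  exists m1 m2, [/\ J m1, J m2 & forall y, E y -> m1 <= y <= m2].
Proof.
move=> rc EM; have EMl y : E y -> - M <= y <= M by rewrite -ler_norml; exact: EM.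
case: rc => [->|[[[a [->|->]] EJ]|[[a [-> [m am Em]]]|[[b [-> [m mb Em]]]|]]]].
- by exists (- M), M.
- exists a, (Num.max a M); split=> [||y Ey].
  + by rewrite /= in_itv /= lexx.
  + by rewrite /= in_itv /= andbT le_max lexx.
  + have := EJ _ Ey; rewrite /= in_itv /= andbT => ->.
    by have /andP[_ yM] := EMl _ Ey; rewrite le_max yM orbT.
- exists (Num.min a (- M)), a; split=> [||y Ey].
  + by rewrite /= in_itv /= ge_min lexx.
  + by rewrite /= in_itv /= lexx.
  + have := EJ _ Ey; rewrite /= in_itv /= => ->.
    by have /andP[yM _] := EMl _ Ey; rewrite ge_min yM orbT.
- exists m, (Num.max m M); split=> [||y Ey].
  + by rewrite /= in_itv /= andbT.
  + by rewrite /= in_itv /= andbT lt_max am.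
  + have := Em _ Ey; rewrite /= in_itv /= andbT => ->.
    by have /andP[_ yM] := EMl _ Ey; rewrite le_max yM orbT.
- exists (Num.min m (- M)), m; split=> [||y Ey].
  + by rewrite /= in_itv /= gt_min mb.
  + by rewrite /= in_itv.
  + have := Em _ Ey; rewrite /= in_itv /= => ->.
    by have /andP[yM _] := EMl _ Ey; rewrite ge_min yM orbT.
- by case=> _ [m1 [m2 [Jm1 Jm2 E12]]]; exists m1, m2; split=> // y /E12.
Qed.

Lemma segment_ubound (R : realType) (J : set R) (h : R -> R) (m1 m2 : R) :
  is_interval J -> J m1 -> J m2 -> {within J, continuous h} ->
  exists2 C, 0 <= C & forall s, m1 <= s <= m2 -> h s <= C.
Proof.
move=> Ji J1 J2 ch; have [m12|m21] := leP m1 m2; last first.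
  by exists 0 => // s /andP[h1 h2]; have := le_trans h1 h2; rewrite leNgt m21.
have [|c _ hc] := @EVT_max R h m1 m2 m12.
  by apply: continuous_subspaceW ch => s /=; rewrite in_itv /=; exact: Ji.
exists (Num.max 0 (h c)) => [|s sI]; first by rewrite le_max lexx.
by rewrite le_max hc ?orbT// in_itv.
Qed.

(** Allows division by the diameter when [mu] is chosen. The upper bound has to be proved first,
    since [sup] dominates its elements only for a bounded set. *)
Lemma diam_gt0 (R : realType) n (U : set 'rV[R]_n) :
  (0 < n)%N -> U !=set0 -> open U -> bounded_set U -> 0 < diam U.
Proof.
move=> n0 [x Ux] Uo /bounded_setP[M M0 UM].
pose e : 'rV[R]_n := delta_mx 0 (Ordinal n0).
have coordM (y : 'rV[R]_n) i : `|y 0 i| <= `|y|.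
  rewrite [leRHS]/Num.Def.normr /= mx_normrE.
  exact: (le_bigmax _ (fun ij : 'I_1 * 'I_n => `|y ij.1 ij.2|) (0, i)).
have UE : has_ubound [set enorm (p.1 - p.2) | p in closure U `*` closure U].
  exists (Num.sqrt (\sum_(i < n) (2 * M) ^+ 2)) => _ [[y z] [/= Uy Uz] <-].
  apply: ler_wsqrtr; apply: ler_sum => i _.
  rewrite -expr2 -[leLHS]real_normK ?num_real//.
  rewrite ler_pXn2r// ?nnegrE ?mulr_ge0 ?(ltW M0)//.
  rewrite (le_trans (coordM _ _))// (le_trans (ler_normB _ _))//.
  have := closure_norm_le UM Uy; have := closure_norm_le UM Uz; lra.
have [s s0 Us] : exists2 s : R, s != 0 & U (x + s *: e).
  have : (fun s : R => x + s *: e) @ (0 : R) --> x + (0 : R) *: e.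
    by apply: cvgD; [exact: cvg_cst|apply: cvgZl; exact: cvg_id].
  rewrite scale0r addr0 => /(_ U (open_nbhs_nbhs (conj Uo Ux))).
  move=> /near_norm[r r0 rU]; exists (r / 2); first by rewrite gt_eqF// divr_gt0.
  by apply: rU; rewrite subr0 gtr0_norm ?divr_gt0// ltr_pdivrMr// ltr_pMr// ltr1n.
have pos : 0 < enorm ((x + s *: e) - x).
  rewrite lt_neqAle enorm_ge0 andbT eq_sym sqrtr_eq0 -ltNge lt_neqAle.
  rewrite dotvv_ge0 andbT eq_sym dotvv_eq0 addrAC subrr add0r scaler_eq0 negb_or s0.
  apply/eqP => /rowP/(_ (Ordinal n0)); rewrite !mxE !eqxx => /eqP.
  by rewrite oner_eq0.
apply: lt_le_trans pos _; apply: ub_le_sup => //.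
by exists (x + s *: e, x) => //; split=> /=; exact: subset_closure.
Qed.

Lemma limf_esup_near_lt (R : realType) (f : R -> R) (e : R) :
  limf_esup (fun t => (f t)%:E) (pinfty_nbhs R) = 0%E -> 0 < e ->
  exists S : R, forall t, S < t -> f t < e.
Proof.
move=> f0 e0; have : (limf_esup (fun t => (f t)%:E) (pinfty_nbhs R) < e%:E)%E.
  by rewrite f0 lte_fin.
rewrite limf_esupE => /ereal_inf_lt[_ [V [S [_ SV]] <-] Ve]; exists S => t St.
rewrite -lte_fin; apply: le_lt_trans Ve; apply: ereal_sup_ubound.
by exists t => //; exact: SV.
Qed.

(** * Iteration over unit time steps *)

Lemma decay_rate_itv (R : realType) (c0 D M kk zeta : R) :
  0 < c0 -> 0 <= D -> 0 <= M -> 0 <= kk -> 0 <= zeta ->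
  0 < decay_rate c0 D M kk zeta <= 1.
Proof.
move=> c0_gt0 D0 M0 kk0 zeta0.
have den0 : 0 < 2 * kk * M + c0 by rewrite ltr_wpDl// !mulr_ge0.
rewrite /decay_rate mulr_gt0 ?divr_gt0 ?expR_gt0//= mulr_ile1 ?expR_ge0//.
- by rewrite divr_ge0 ?ltW.
- by rewrite ler_pdivrMr// mul1r lerDr !mulr_ge0.
- rewrite -expR0 ler_expR oppr_le0 mulr_ge0 ?addr_ge0 ?mulr_ge0//.
    by rewrite !addr_ge0// mulr_ge0.
  by rewrite invr_ge0 ltW.
Qed.

(** The steepness is affine in the drift, so the drift splits off as an exponential factor; this is
    where the form C1 exp (- C2 b) comes from. *)
Lemma decay_rateE (R : realType) (c0 D M kk m b : R) :
  c0 != 0 ->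
  decay_rate c0 D M kk (m * b) =
  decay_rate c0 D M kk 0 * expR (- (2 * m * (2 * D + 1) / c0 * b)).
Proof.
by move=> c00; rewrite /decay_rate -[RHS]mulrA -expRD; congr (_ * expR _);
  rewrite /steepness; field.
Qed.

(** Once Lam <= e eta, the value e is a barrier for the recursion m -> (1 - eta) m + Lam, and the
    excess over e shrinks by the factor 1 - eta in each step; the products of these factors tend to
    0 because the sums of eta diverge. *)
Lemma subsolution_decay (R : realType) n (U : set 'rV[R]_n)
    (A : 'rV[R]_n * R -> 'M[R]_n) (c0 : R) (z k : 'rV[R]_n * R -> R)
    (F Lam zeta : R -> R) (w : 'rV[R]_n * R -> R) (D M kk Tstar : R) :
  (0 < n)%N -> open U -> U !=set0 -> (forall x, U x -> `|x| <= D) ->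
  (forall p, cylinder U p -> (A p)^T = A p) -> 0 < c0 ->
  (forall p xi, cylinder U p -> c0 * enorm xi ^+ 2 <= quadform (A p) xi) ->
  {within ccylinder U, continuous w} -> C21 (cylinder U) w ->
  subsolution U A z k F w ->
  {within `[0, +oo[, continuous F} -> (forall s, 0 <= s -> 0 <= F s) ->
  0 <= M -> (forall x t, closure U x -> 0 <= t -> w (x, t) <= M) ->
  0 <= kk -> (forall p, cylinder U p -> k p <= kk) ->
  (forall t, 0 <= t -> 0 <= zeta t) ->
  (forall x t s, U x -> 0 <= t -> t < s <= t + 1 -> z (x, s) <= zeta t) ->
  0 <= Tstar ->
  (forall t, Tstar <= t ->
     \int[lebesgue_measure]_(s in `[t, t + 1]) F s <= Lam t) ->
  (forall x t s, bdry U x -> Tstar <= t -> t <= s <= t + 1 ->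
     w (x, s) + \int[lebesgue_measure]_(s in `[t, t + 1]) F s <= Lam t) ->
  let eta t := decay_rate c0 D M kk (zeta t) in
  (forall e, 0 < e -> \forall t \near +oo, Lam t <= e * eta t) ->
  (\forall T0 \near +oo, forall X,
     exists N, X <= \sum_(i < N) eta (T0 + i%:R)) ->
  forall e, 0 < e ->
    \forall t \near +oo, forall x, closure U x -> w (x, t) <= e.
Proof.
move=> n0 Uo U0 UD Asym c0_gt0 Aell wc w21 wsub Fc F0 M0 wM kk0 kkk zeta0 zzeta.
move=> Ts0 LamF Lamb eta Lamsmall etadiv e' e'0.
(* Four contributions of size [e] add up at the end: the boundary data, the fixed part of the
   recursion, its decaying part, and the integral of [F] within the last unit of time. *)
pose e := e' / 4; have e0 : 0 < e by rewrite divr_gt0.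
have D0 : 0 <= D by case: U0 => y /UD; exact: le_trans.
have Ub : bounded_set U.
  exists D; split; first exact: num_real.
  by move=> r Dr y /UD yD; rewrite /= (le_trans yD)// ltW.
have [S [_ SLam]] := Lamsmall _ e0.
have [S' [_ Sdiv]] := etadiv.
pose T0 := Num.max (Num.max S S' + 1) Tstar.
have T0S : S < T0.
  by rewrite lt_max (le_lt_trans (_ : _ <= Num.max S S'))// ?ltrDl// le_max lexx.
have T0S' : S' < T0.
  rewrite lt_max (le_lt_trans (_ : _ <= Num.max S S'))// ?ltrDl//.
  by rewrite le_max lexx orbT.
have T0s : Tstar <= T0 by rewrite le_max lexx orbT.
have T00 : 0 <= T0 by exact: le_trans T0s.
have eta01 t : 0 <= t -> 0 < eta t <= 1.
  by move=> t0; apply: decay_rate_itv => //; exact: zeta0.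
pose Phi t := \int[lebesgue_measure]_(s in `[0, t]) F s.
have dPhi (t : R) : 0 < t -> is_derive t 1 Phi (F t) by exact: primitive_derive.
have Phic a b : 0 <= a -> {within `[a, b], continuous Phi}.
  by move=> a0; exact: primitive_continuous.
have PhiD a b : 0 <= a -> a <= b ->
    Phi b - Phi a = \int[lebesgue_measure]_(s in `[a, b]) F s.
  by move=> a0 ab; rewrite /Phi (@Rintegral_split _ F 0 a b)//;
    [rewrite addrC addKr|rewrite a0].
have Phile a b : 0 <= a -> a <= b -> Phi a <= Phi b.
  by move=> a0 ab; rewrite -subr_ge0 PhiD//; exact: Rintegral_itv_ge0.
pose p N := \prod_(i < N) (1 - eta (T0 + i%:R)).
have TN0 (N : nat) : 0 <= T0 + N%:R by rewrite addr_ge0.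
have eta01N (N : nat) : 0 <= eta (T0 + N%:R) <= 1.
  by have /andP[/ltW -> ->] := eta01 _ (TN0 N).
have p0 N : 0 <= p N.
  by apply: prodr_ge0 => i _; rewrite subr_ge0; case/andP: (eta01N i).
have TN (N : nat) : T0 <= T0 + N%:R by rewrite lerDl.
have LamN (N : nat) : Lam (T0 + N%:R) <= e * eta (T0 + N%:R).
  by apply: SLam; exact: lt_le_trans (TN N).
have LamNe (N : nat) : Lam (T0 + N%:R) <= e.
  apply: le_trans (LamN N) _; rewrite ger_pMr//.
  by have /andP[_] := eta01N N.
(* The minimum with [M] keeps the bound in the range where the fixed rate [eta], built from [M], is
   admissible in [growth]. *)
have step N x : closure U x -> w (x, T0 + N%:R) <= Num.min M (e + M * p N).
  elim: N x => [|N IH] x Ux; rewrite le_min wM//= /p.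
    rewrite big_ord0 mulr1; have := wM x (T0 + 0%:R) Ux (TN0 0).
    by have := e0; lra.
  rewrite big_ord_recr/= -/(p N) -natr1 addrA; set a := T0 + N%:R.
  have aTs : Tstar <= a by exact: le_trans (TN N).
  have a0 : 0 <= a by exact: TN0.
  set m := Num.min _ _ in IH.
  have m0 : 0 <= m by rewrite le_min M0 addr_ge0 ?(ltW e0)// mulr_ge0.
  have a1 : a <= a + 1 by rewrite lerDl.
  (* What [Lam a] leaves for the boundary values after the integral of [F]. The maximum makes
     nonnegativity evident; by [LamF] it changes nothing. *)
  pose beta := Num.max 0 (Lam a - (Phi (a + 1) - Phi a)).
  have betaE : beta = Lam a - (Phi (a + 1) - Phi a).
    by rewrite /beta PhiD//; apply/max_idPr; rewrite subr_ge0 LamF.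
  have := @growth R n U A c0 z k F w Phi a beta m M D kk (zeta a) n0 Uo U0 UD Asym
    c0_gt0 Aell wc w21 wsub a0 (Phic _ _ a0) _ _ _ _ kk0 (zeta0 _ a0) _ _ IH x Ux.
  rewrite -/(eta a) => H.
  have {H} : w (x, a + 1) <= beta + (Phi (a + 1) - Phi a) + m * (1 - eta a).
    apply: H => [t /andP[at_ _]|t /andP[at_ _]||||y s Uy sI].
    - by apply: dPhi; exact: le_lt_trans at_.
    - exact: Phile.
    - by rewrite le_max lexx.
    - by rewrite m0 ge_min lexx.
    - move=> y s Uy sI; split; first exact: zzeta.
      apply: kkk; apply/cylinderE; split=> //.
      by case/andP: sI => /(le_lt_trans a0).
    - by rewrite betaE PhiD// lerBrDr; exact: Lamb.
  rewrite betaE subrK => wle; apply: le_trans wle _.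
  have /andP[eta0 eta1] := eta01N N; rewrite -/a in eta0 eta1.
  have : m * (1 - eta a) <= (e + M * p N) * (1 - eta a).
    by rewrite ler_wpM2r ?subr_ge0// ge_min lexx orbT.
  by have := LamN N; rewrite -/a; lra.
have [N0 N0p] : exists N0, forall N, (N0 <= N)%N -> M * p N <= e.
  (* A sum of size M / e is enough: M exp (- M / e) <= e follows from 1 + x <= exp x. *)
  have [N0 XN0] := Sdiv _ T0S' (M / e).
  exists N0 => N NN0; apply: (@le_trans _ _ (M * p N0)).
    rewrite ler_wpM2l//; elim: N NN0 => [|N IH]; first by rewrite leqn0 => /eqP ->.
    rewrite leq_eqVlt => /predU1P[->//|]; rewrite ltnS => /IH; apply: le_trans.
    rewrite /p big_ord_recr/= -/(p N) ler_piMr// lerBlDl lerDr.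
    by case/andP: (eta01N N).
  have pN : p N0 <= expR (- (M / e)).
    apply: le_trans (prodr_1B_le_expR _ eta01N) _.
    by rewrite ler_expR lerN2.
  rewrite (le_trans (ler_wpM2l M0 pN))// expRN ler_pdivrMr ?expR_gt0//.
  have := expR_ge1Dx (M / e) => /(ler_wpM2l (ltW e0)); apply: le_trans.
  by rewrite mulrDr mulr1 mulrCA divff ?gt_eqF// mulr1 lerDr ltW.
exists (T0 + N0%:R); split; first exact: num_real.
move=> t tN0 x Ux; pose N := Num.trunc (t - T0).
have tT0 : 0 <= t - T0 by rewrite subr_ge0 (le_trans _ (ltW tN0))// lerDl.
have /andP[Nt tN] := truncn_itv tT0; rewrite -/N in Nt tN.
have NN0 : (N0 <= N)%N by rewrite truncn_ge_nat// lerBrDl ltW.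
set a := T0 + N%:R.
have aTs : Tstar <= a by exact: le_trans (TN N).
have a0 : 0 <= a by exact: TN0.
have tI : a <= t <= a + 1.
  by rewrite /a -addrA natr1; apply/andP; split; lra.
have Phi0 : 0 <= Phi (a + 1) - Phi a by rewrite subr_ge0 Phile// lerDl.
have PhiLam : Phi (a + 1) - Phi a <= Lam a by rewrite PhiD// ?LamF// lerDl.
have := LamNe N; rewrite -/a => Lame.
(* The recursion controls only the times T0 + N; the maximum principle carries the bound to the
   times in between. *)
have := @weak_max_principle R n U A c0 z k F w Phi a (a + 1)
  (Lam a + (e + M * p N)) n0 Uo Ub U0 Asym c0_gt0 Aell wc w21 wsub a0 (Phic _ _ a0).
move=> /(_ _ _ _ _ x t Ux tI) H.
have {H} : w (x, t) <= Lam a + (e + M * p N) + (Phi t - Phi a).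
  apply: H => [s /andP[as_ _]|s /andP[as_ _]|y s Uy sI|y Uy].
  - by apply: dPhi; exact: le_lt_trans as_.
  - exact: Phile.
  - have := Lamb _ _ _ Uy aTs sI; rewrite -PhiD// ?lerDl//.
    by have : 0 <= M * p N := mulr_ge0 M0 (p0 N); have := e0; lra.
  - have := step N y Uy; rewrite le_min -/a => /andP[_].
    by have : 0 <= Lam a := le_trans Phi0 PhiLam; lra.
have : Phi t <= Phi (a + 1).
  by case/andP: tI => at_ t1; apply: Phile => //; exact: le_trans at_.
have eE : e' = 4 * e by rewrite /e mulrC divfK.
by have := N0p _ NN0; rewrite eE; lra.
Qed.

(** * From the equation to the differential inequality, and the conclusion *)

Lemma dotv_mul_tr (R : realType) n (M : 'M[R]_n) (v : 'rV[R]_n) :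
  dotv (v *m M^T) v = quadform M v.
Proof.
rewrite /quadform -[LHS]/(\sum_i (v *m M^T) 0 i * v 0 i).
have -> : (v *m M *m v^T) 0 0 = (v *m M^T *m v^T) 0 0.
  have -> : v *m M^T *m v^T = (v *m M *m v^T)^T.
    by rewrite !trmx_mul trmxK mulmxA.
  by rewrite [RHS]mxE.
by rewrite mxE; apply: eq_bigr => i _; rewrite [v^T _ _]mxE.
Qed.

Lemma normr_sqr1 (R : realDomainType) (x : R) : x ^+ 2 = 1 -> `|x| = 1.
Proof.
by move=> x2; apply/eqP; rewrite -(eqrXn2 (ltn0Sn 1))// expr1n -normrX x2 normr1.
Qed.

(** The equation is solved for its linear principal part and estimated in absolute value, so
    multiplication by sigma = 1 or -1 is harmless. Cauchy-Schwarz handles the drift; the two-sided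
    bound on [K] gives c1 + c2 for the quadratic term. *)
Lemma subsolution_scale_shift (R : realType) n (U : set 'rV[R]_n) (J : set R)
    (P : R -> R) (A K : 'rV[R]_n * R -> 'M[R]_n)
    (B : 'rV[R]_n * R -> R -> 'rV[R]_n) (c1 c2 : R) (u f : 'rV[R]_n * R -> R)
    (F : R -> R) (sigma b : R) :
  0 <= c1 -> 0 <= c2 ->
  (forall p xi, cylinder U p ->
     - c1 * enorm xi ^+ 2 <= quadform (K p) xi <= c2 * enorm xi ^+ 2) ->
  (forall p, cylinder U p -> J (u p)) ->
  (forall s, J s -> 0 <= derive_in J P s) ->
  (forall p, cylinder U p -> Lop J P A K B u p = f p) ->
  (forall p, cylinder U p -> `|f p| <= F p.2) ->
  sigma ^+ 2 = 1 ->
  subsolution U A (fun p => enorm (B p (u p)))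
    (fun p => derive_in J P (u p) * (c1 + c2)) F (fun p => sigma * u p + b).
Proof.
move=> c1_ge0 c2_ge0 K_bounds u_J P'_ge0 u_eq f_bound s2 p Up; have s0 : sigma != 0.
  by apply/eqP => s0; move: s2 => /eqP; rewrite s0 expr0n /= eq_sym oner_eq0.
have s1 := normr_sqr1 s2.
rewrite dt_scale_shift// hess_scale_shift// grad_scale_shift//.
have -> : enorm (sigma *: grad u p) = enorm (grad u p).
  congr Num.sqrt; apply: eq_bigr => i _; rewrite !mxE.
  by rewrite mulrACA -expr2 s2 mul1r.
rewrite -scalemxAr mxtraceZ -mulrBr.
have := u_eq _ Up; rewrite /Lop => E.
have -> : dt u p - \tr ((A p)^T *m hess u p) =
    f p - dotv (B p (u p)) (grad u p) -
    derive_in J P (u p) * dotv (grad u p *m (K p)^T) (grad u p).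
  by rewrite -E; ring.
have fF := f_bound _ Up.
have BG := ler_dotv (B p (u p)) (grad u p).
have KG : `|dotv (grad u p *m (K p)^T) (grad u p)| <=
    (c1 + c2) * enorm (grad u p) ^+ 2.
  have -> : dotv (grad u p *m (K p)^T) (grad u p) = quadform (K p) (grad u p).
    exact: dotv_mul_tr.
  have /andP[K1 K2] := K_bounds p (grad u p) Up.
  have h1 : 0 <= c1 * enorm (grad u p) ^+ 2 by rewrite mulr_ge0// sqr_ge0.
  have h2 : 0 <= c2 * enorm (grad u p) ^+ 2 by rewrite mulr_ge0// sqr_ge0.
  by rewrite ler_norml; apply/andP; split; lra.
have P0 := P'_ge0 _ (u_J _ Up).
apply: le_trans (ler_norm _) _; rewrite normrM s1 mul1r.
apply: le_trans (ler_normB _ _) _; apply: lerD.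
  by apply: le_trans (ler_normB _ _) _; exact: lerD.
by rewrite normrM ger0_norm// -mulrA ler_wpM2l.
Qed.

Theorem theorem5p7 (R : realType) (n : nat) (hn : (1 <= n)%N)
  (U : set 'rV[R]_n) (U_neq0 : U !=set0) (U_open : open U)
  (U_bounded : bounded_set U)
  (J : set R) (J_itv : is_interval J) (J_int : interior J !=set0)
  (P : R -> R) (P_C1 : C1_in J P)
  (P'_ge0 : forall s, J s -> 0 <= derive_in J P s)
  (A K : 'rV[R]_n * R -> 'M[R]_n) (B : 'rV[R]_n * R -> R -> 'rV[R]_n)
  (A_sym : forall p, cylinder U p -> (A p)^T = A p)
  (c0 M1 c1 c2 : R) (c0_gt0 : 0 < c0) (M1_gt0 : 0 < M1)
  (c1_ge0 : 0 <= c1) (c2_ge0 : 0 <= c2)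
  (A_elliptic : forall p xi, cylinder U p ->
     c0 * enorm xi ^+ 2 <= quadform (A p) xi)
  (A_trace : forall p, cylinder U p -> \tr (A p) <= M1)
  (K_bounds : forall p xi, cylinder U p ->
     - c1 * enorm xi ^+ 2 <= quadform (K p) xi <= c2 * enorm xi ^+ 2)
  (u : 'rV[R]_n * R -> R)
  (u_cont : {within ccylinder U, continuous u})
  (u_C21 : C21 (cylinder U) u)
  (u_J : forall p, cylinder U p -> J (u p))
  (f g : 'rV[R]_n * R -> R) (u0 : 'rV[R]_n -> R)
  (u_eq : forall p, cylinder U p -> Lop J P A K B u p = f p)
  (u_bdry : forall x t, bdry U x -> 0 < t -> u (x, t) = g (x, t))
  (u_init : forall x, U x -> u (x, 0) = u0 x)
  (u_range : range_condition J (u @` ccylinder U))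
  (bbar : R -> R) (gamma0 : R)
  (bbar_cont : {within `[0, +oo[, continuous bbar})
  (bbar_incr : {in `[0, +oo[ &, {homo bbar : s t / s <= t}})
  (bbar_ge0 : forall t, 0 <= t -> 0 <= bbar t)
  (bbar_lim : bbar t @[t --> +oo] --> +oo)
  (gamma0_gt0 : 0 < gamma0)
  (B_bound : forall p s, cylinder U p -> J s ->
     enorm (B p s) <= bbar p.2 * (1 + `|s|) `^ gamma0)
  (F : R -> R)
  (F_cont : {within `[0, +oo[, continuous F})
  (F_ge0 : forall t, 0 <= t -> 0 <= F t)
  (f_bound : forall p, cylinder U p -> `|f p| <= F p.2)
  (F_int : (\int[lebesgue_measure]_(t in `[0%R, +oo[) (F t)%:E < +oo)%E)
  (ustar Tstar : R) (Lamt : R -> R)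
  (ustar_J : J ustar) (Tstar_gt0 : 0 < Tstar)
  (Lamt_ge0 : forall t, Tstar <= t -> 0 <= Lamt t)
  (Lamt_decr : {in `[Tstar, +oo[ &, {homo Lamt : s t /~ s <= t}})
  (Lamt_cont : {within `[Tstar, +oo[, continuous Lamt})
  (* g = u is continuous on the nonempty compact set bdry U x [t, t + 1], so
     the supremum is a maximum *)
  (Lamt_bound : forall t, Tstar <= t ->
     sup [set `|g p - ustar| | p in bdry U `*` `[t, t + 1]]
     + \int[lebesgue_measure]_(tau in `[t, t + 1]) F tau <= Lamt t)
  (Z_cond : forall mu : R, 0 < mu ->
     let d := diam U in
     let z0 := fun t : R => mu * bbar t in
     let Lam := fun t : R => Lamt (t / 4) in
     condition_Z d c0 0 (4 * Tstar) z0 Lam /\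
     limf_esup (fun t : R => (Lam t * expR (d / c0 * z0 t))%:E)
       (pinfty_nbhs R) = 0%E) :
  (* the supremum over the nonempty compact set closure U is a maximum *)
  sup [set `|u (x, t) - ustar| | x in closure U] @[t --> +oo] --> 0.
Proof.
have n0 : (0 < n)%N by [].
have [D D0 UD] := bounded_setP U_bounded.
have Ucl x : U x -> closure U x by exact: subset_closure.
pose k p := derive_in J P (u p) * (c1 + c2).
pose z p := enorm (B p (u p)).
have sgn1 : (1 : R) ^+ 2 = 1 by rewrite expr1n.
have sgnN1 : (-1 : R) ^+ 2 = 1 by rewrite sqrrN expr1n.
have v_cont sigma b : {within ccylinder U, continuous (fun p => sigma * u p + b)}.
  exact: within_continuous_scale_shift.
pose dev p := `|u p - ustar|.
have dev_bound T : exists M,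
    forall x t, closure U x -> 0 <= t <= T -> dev (x, t) <= M.
  have Kc : compact (closure U `*` `[0, T]).
    by apply: compact_setX; [exact: compact_closure_bounded|exact: segment_compact].
  have uK : {within closure U `*` `[0, T], continuous dev}.
    have : {within ccylinder U, continuous dev}.
      move=> p; apply: cvg_norm; apply: cvgB; first exact: u_cont.
      exact: cvg_cst.
    apply: continuous_subspaceW => -[x t] [/= Ux]; rewrite in_itv /= => /andP[t0 _].
    exact/ccylinderE.
  have [T0|T0] := leP 0 T; last first.
    by exists 0 => x t _ /andP[t0 tT]; have := le_trans t0 tT; rewrite leNgt T0.
  have [|c _ cmax] := compact_EVT_max _ Kc uK.
    case: U_neq0 => x Ux; exists (x, 0); split=> /=; first exact: Ucl.
    by rewrite in_itv /= lexx.
  by exists (dev c) => x t Ux tI; apply: cmax; rewrite inE; split=> //=.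
(* Times from [Tstar] on are positive, so [g] is [u] there and compactness bounds it; only then does
   the supremum dominate the individual values. *)
have gub t : Tstar <= t ->
    has_ubound [set `|g p - ustar| | p in bdry U `*` `[t, t + 1]].
  move=> Tt; have [M MP] := dev_bound (t + 1).
  exists M => _ [[y r] [/= Uy rI] <-]; move: rI; rewrite in_itv /= => /andP[tr rt].
  have r0 : 0 < r by exact: lt_le_trans Tstar_gt0 (le_trans Tt tr).
  by rewrite -u_bdry//; apply: MP; [exact: Uy.1|rewrite (ltW r0)].
have gdev x t s : bdry U x -> Tstar <= t -> t <= s <= t + 1 ->
    dev (x, s) + \int[lebesgue_measure]_(tau in `[t, t + 1]) F tau <= Lamt t.
  move=> Ux Tt /andP[ts st]; apply: le_trans (Lamt_bound _ Tt); rewrite lerD2r.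
  have s0 : 0 < s by exact: lt_le_trans Tstar_gt0 (le_trans Tt ts).
  apply: ub_le_sup; first exact: gub.
  exists (x, s); first by split=> //=; rewrite in_itv /= ts.
  by rewrite /dev u_bdry.
have FLam t : Tstar <= t ->
    \int[lebesgue_measure]_(tau in `[t, t + 1]) F tau <= Lamt t.
  move=> Tt; apply: le_trans (Lamt_bound _ Tt); rewrite lerDr.
  have := gub _ Tt; set S := [set _ | _ in _] => Sub.
  have [->|/set0P[r Sr]] := eqVneq S set0; first by rewrite sup0.
  have r0 : 0 <= r by case: Sr => p _ <-.
  by apply: (le_trans r0); exact: ub_le_sup Sr.
have Ts0 := ltW Tstar_gt0.
have itv_le1 (t : R) : t <= t <= t + 1 by rewrite lexx lerDl ler01.
have sigma_dev sigma p : sigma ^+ 2 = 1 -> sigma * (u p - ustar) <= dev p.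
  move=> s2; apply: le_trans (ler_norm _) _.
  by rewrite normrM normr_sqr1// mul1r.
pose w sigma p := sigma * u p + - sigma * ustar.
have wE sigma p : w sigma p = sigma * (u p - ustar) by rewrite /w; ring.
have w_sub sigma : sigma ^+ 2 = 1 -> subsolution U A z k F (w sigma).
  move=> s2; exact: (subsolution_scale_shift _ c1_ge0 c2_ge0 K_bounds u_J P'_ge0
    u_eq f_bound s2).
have w_cont sigma : {within ccylinder U, continuous (w sigma)} by exact: v_cont.
have w_C21 sigma : sigma ^+ 2 = 1 -> C21 (cylinder U) (w sigma).
  move=> s2; apply: C21_scale_shift => //; apply/eqP => s0.
  by move: s2 => /eqP; rewrite s0 expr0n /= eq_sym oner_eq0.
pose Itot := fine (\int[lebesgue_measure]_(t in `[0%R, +oo[) (F t)%:E).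
(* Global bound: compactness up to time [Tstar], the decreasing [Lamt] on the lateral boundary
   afterwards, and the maximum principle from time 0, which adds at most the total integral of
   [F]. *)
have [M M0 devM] : exists2 M, 0 <= M &
    forall x t, closure U x -> 0 <= t -> dev (x, t) <= M.
  have [m mP] := dev_bound Tstar.
  pose m' := Num.max m (Lamt Tstar).
  have m'P x t : bdry U x -> 0 <= t -> dev (x, t) <= m'.
    move=> Ux t0; rewrite le_max; have [tT|Tt] := leP t Tstar.
      by rewrite mP//; [exact: Ux.1|rewrite t0].
    have := gdev _ _ _ Ux (ltW Tt) (itv_le1 _).
    have : 0 <= \int[lebesgue_measure]_(tau in `[t, t + 1]) F tau.
      exact: Rintegral_itv_ge0.
    have : Lamt t <= Lamt Tstar.
      by apply: Lamt_decr; rewrite ?in_itv /= ?andbT ?lexx ?(ltW Tt).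
    move=> h1 h2 h3; apply/orP; right; lra.
  have devm x t : closure U x -> 0 <= t -> dev (x, t) <= m' + Itot.
    move=> Ux t0.
    have key sigma : sigma ^+ 2 = 1 -> w sigma (x, t) <= m' + Itot.
      move=> s2.
      have := @weak_max_principle R n U A c0 z k F (w sigma)
        (fun s => \int[lebesgue_measure]_(r in `[0, s]) F r) 0 t m' n0 U_open
        U_bounded U_neq0 A_sym c0_gt0 A_elliptic (w_cont _) (w_C21 _ s2)
        (w_sub _ s2) (lexx _) (@primitive_continuous R F 0 t F_cont (lexx _)).
      move=> /(_ _ _ _ _ x t Ux _) H.
      have {H} : w sigma (x, t) <= m' + (\int[lebesgue_measure]_(r in `[0, t]) F r -
          \int[lebesgue_measure]_(r in `[0, 0]) F r).
        apply: H => [s /andP[s0 _]|s /andP[s0 _]|y s Uy /andP[s0 _]|y Uy|].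
        - exact: primitive_derive.
        - by rewrite set_itv1 Rintegral_set1; exact: Rintegral_itv_ge0.
        - by rewrite wE; apply: le_trans (sigma_dev _ _ s2) _; exact: m'P.
        - rewrite wE; apply: le_trans (sigma_dev _ _ s2) _.
          by rewrite le_max mP// lexx.
        - by rewrite t0 lexx.
      rewrite set_itv1 Rintegral_set1 subr0 => H; apply: le_trans H _.
      by rewrite lerD2l; exact: Rintegral_itv_le_ray.
    rewrite /dev; case: ger0P => _.
      by have := key 1 sgn1; rewrite wE mul1r.
    by have := key (-1) sgnN1; rewrite wE mulN1r.
  exists (m' + Itot) => //; have [x Ux] := U_neq0.
  by apply: le_trans (devm x 0 (Ucl _ Ux) (lexx _)); exact: normr_ge0.
have [m1 [m2 [Jm1 Jm2 um]]] : exists m1 m2, [/\ J m1, J m2 &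
    forall y, (u @` ccylinder U) y -> m1 <= y <= m2].
  apply: (range_condition_segment (M := `|ustar| + M)) => // _ [[x t] + <-].
  move=> /ccylinderE[Ux t0]; have := devM _ _ Ux t0; rewrite /dev => h.
  by have := ler_normD (u (x, t) - ustar) ustar; rewrite subrK; lra.
have [C C0 PC] := segment_ubound J_itv Jm1 Jm2 P_C1.2.
have uM x t : closure U x -> 0 <= t -> `|u (x, t)| <= `|ustar| + M.
  move=> Ux t0; have := devM _ _ Ux t0; rewrite /dev => h.
  by have := ler_normD (u (x, t) - ustar) ustar; rewrite subrK; lra.
pose kk := C * (c1 + c2).
have kk0 : 0 <= kk by rewrite mulr_ge0// addr_ge0.
have k_le p : cylinder U p -> k p <= kk.
  move=> Up; rewrite ler_wpM2r ?addr_ge0//; apply/PC/um; exists p => //.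
  case: p Up => x t /cylinderE[Ux t0]; apply/ccylinderE.
  by split; [exact: Ucl|exact: ltW].
pose mu0 := (1 + (`|ustar| + M)) `^ gamma0.
have base0 : 0 < 1 + (`|ustar| + M) by rewrite ltr_pwDl// addr_ge0.
have mu0_gt0 : 0 < mu0 by exact: powR_gt0.
(* As [bbar] increases, its value at the right end bounds the drift on the whole unit interval after
   [t]; [mu0] absorbs the power of 1 + |u|. *)
pose zeta t := mu0 * bbar (t + 1).
have zeta0 t : 0 <= t -> 0 <= zeta t.
  by move=> t0; rewrite mulr_ge0 ?(ltW mu0_gt0)// bbar_ge0// addr_ge0.
have z_le x t s : U x -> 0 <= t -> t < s <= t + 1 -> z (x, s) <= zeta t.
  move=> Ux t0 /andP[ts st]; have s0 : 0 < s by exact: le_lt_trans ts.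
  have Us : cylinder U (x, s) by exact/cylinderE.
  rewrite /z (le_trans (B_bound _ _ Us (u_J _ Us)))//= /zeta mulrC.
  have t10 : 0 <= t + 1 by rewrite addr_ge0.
  rewrite ler_pM ?powR_ge0 ?bbar_ge0 ?(ltW s0)//.
    apply: ge0_ler_powR; rewrite ?(ltW gamma0_gt0)// ?nnegrE ?(ltW base0)//.
    by rewrite lerD2l uM//; [exact: Ucl|exact: ltW].
  by apply: bbar_incr => //; rewrite in_itv /= andbT// ltW.
pose eta t := decay_rate c0 D M kk (zeta t).
pose C2 := 2 * mu0 * (2 * D + 1) / c0.
have C2_gt0 : 0 < C2.
  by rewrite divr_gt0// !mulr_gt0// ltr_wpDl// mulr_ge0// ltW.
pose C1 := decay_rate c0 D M kk 0.
have C1_gt0 : 0 < C1.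
  by have /andP[] := decay_rate_itv c0_gt0 (ltW D0) M0 kk0 (lexx 0).
pose h t := expR (- (C2 * bbar t)).
have etaE t : eta t = C1 * h (t + 1).
  by rewrite /eta /zeta decay_rateE// gt_eqF.
have d_gt0 : 0 < diam U by exact: diam_gt0.
pose mu := C2 * c0 / diam U.
have mu_gt0 : 0 < mu by rewrite divr_gt0// mulr_gt0.
have muE t : diam U / c0 * (mu * bbar t) = C2 * bbar t.
  by rewrite /mu; field; rewrite !gt_eqF.
have [Zcond Zlim] := Z_cond _ mu_gt0.
(* [eta t] involves [bbar (t + 1)], so the upper limit is used at t + 1; since [Lamt] decreases and
   Tstar <= (t + 1) / 4 <= t, it bounds [Lamt t] too. *)
have Lam_small e : 0 < e -> \forall t \near +oo, Lamt t <= e * eta t.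
  move=> e0; have [S SP] := limf_esup_near_lt Zlim (mulr_gt0 e0 C1_gt0).
  exists (Num.max S (4 * Tstar + 1)); split; first exact: num_real.
  move=> t; rewrite gt_max => /andP[St Tt].
  have t1S : S < t + 1 by lra.
  have := SP _ t1S; rewrite muE etaE => H.
  have : Lamt t <= Lamt ((t + 1) / 4).
    by apply: Lamt_decr; rewrite ?in_itv /= ?andbT; lra.
  move=> LL; rewrite mulrA /h expRN ler_pdivlMr ?expR_gt0//; apply: ltW.
  by apply: le_lt_trans H; rewrite ler_wpM2r// expR_ge0.
have h_cont : {within `[0, +oo[, continuous h}.
  apply: (@within_continuous_comp _ _ _ _ (fun s => - (C2 * bbar s)) expR).
    by move=> y _; exact: continuous_expR.
  move=> t; apply: cvgN; apply: cvgM; first exact: cvg_cst.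
  exact: bbar_cont.
have h0 s : 0 <= s -> 0 <= h s by rewrite expR_ge0.
have h_decr : {in `[0, +oo[ &, {homo h : s t /~ s <= t}}.
  move=> s t sI tI st; rewrite ler_expR lerN2 ler_pM2l//.
  exact: bbar_incr.
have eta_div : \forall T0 \near +oo, forall X,
     exists N, X <= \sum_(i < N) eta (T0 + i%:R).
  have [T [t1 [eps1 [[T0 _] _ _ Zoo _]]]] := Zcond.
  have hoo : (\int[lebesgue_measure]_(s in `[T, +oo[) (h s)%:E = +oo)%E.
    by rewrite -Zoo; apply: eq_integral => s _; rewrite muE.
  exists T; split; first exact: num_real.
  move=> S TS X.
  (* The same shift by one: the sum of [eta] from [S] is a sum of [h] from S + 1. *)
  have S1T : T <= S + 1 by apply: ltW; apply: (lt_trans TS); rewrite ltrDl.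
  have [N NX] := integral_test (X / C1) h_cont h0 h_decr T0 hoo S1T.
  exists N.
  have -> : \sum_(i < N) eta (S + i%:R) = C1 * \sum_(i < N) h (S + 1 + i%:R).
    by rewrite mulr_sumr; apply: eq_bigr => i _; rewrite etaE addrAC.
  by rewrite -ler_pdivrMl// mulrC.
have decay sigma e : sigma ^+ 2 = 1 -> 0 < e ->
    \forall t \near +oo, forall x, closure U x -> w sigma (x, t) <= e.
  move=> s2.
  have wM x t : closure U x -> 0 <= t -> w sigma (x, t) <= M.
    by move=> Ux t0; rewrite wE (le_trans (sigma_dev _ _ s2))// devM.
  have wLam x t s : bdry U x -> Tstar <= t -> t <= s <= t + 1 ->
      w sigma (x, s) + \int[lebesgue_measure]_(r in `[t, t + 1]) F r <= Lamt t.
    move=> Ux Tt ts; apply: le_trans (gdev _ _ _ Ux Tt ts).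
    by rewrite lerD2r wE sigma_dev.
  exact: (subsolution_decay n0 U_open U_neq0 UD A_sym c0_gt0 A_elliptic
    (w_cont sigma) (w_C21 _ s2) (w_sub _ s2) F_cont F_ge0 M0 wM kk0 k_le zeta0
    z_le Ts0 FLam wLam Lam_small eta_div).
apply/cvgrPdist_le => e e0.
have near0 : \forall t \near +oo, (0 : R) <= t by exact: nbhs_pinfty_ge.
near=> t.
have t0 : 0 <= t by near: t.
have w1 x : closure U x -> w 1 (x, t) <= e.
  by move: x; near: t; exact: decay.
have w2 x : closure U x -> w (-1) (x, t) <= e.
  by move: x; near: t; exact: decay.
have dev_le x : closure U x -> dev (x, t) <= e.
  move=> Ux; rewrite /dev; case: ger0P => _.
    by have := w1 _ Ux; rewrite wE mul1r.
  by have := w2 _ Ux; rewrite wE mulN1r.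
have [x0 Ux0] := U_neq0; have cUx0 := Ucl _ Ux0.
have ub : ubound [set `|u (x, t) - ustar| | x in closure U] e.
  by move=> _ [x Ux <-]; exact: dev_le.
have im0 : [set `|u (x, t) - ustar| | x in closure U] (dev (x0, t)).
  by exists x0.
rewrite sub0r normrN ger0_norm; first by apply: ge_sup => //; exists (dev (x0, t)).
apply: (@le_trans _ _ (dev (x0, t))); first exact: normr_ge0.
by apply: ub_le_sup => //; exists e.
Unshelve. all: by end_near. Qed.
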